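(* Let $X,Y$ be computable Banach spaces. Then $\mathsf{CGT}_{X,Y}\le_W\mathsf{C_{\mathbb N}}\equiv_W\mathsf{CGT}_{\ell^2,\ell^2}$.
   Context: A represented space is a pair $(X,\delta_X)$ with $\delta_X:\subseteq\mathbb N^{\mathbb N}\to X$ a partial surjection. For a partial multi-valued map $f:\subseteq X\rightrightarrows Y$ between represented spaces, a realizer of $f$ is a partial function $F:\subseteq\mathbb N^{\mathbb N}\to\mathbb N^{\mathbb N}$ with $\delta_Y(F(p))\in f(\delta_X(p))$ for all $p\in\mathrm{dom}(f\circ\delta_X)$. We write $f\le_W g$ (Weihrauch reducibility) if there are computable partial functions $H,K:\subseteq\mathbb N^{\mathbb N}\to\mathbb N^{\mathbb N}$ such that for every realizer $G$ of $g$ the function $p\mapsto H\langle p,G(K(p))\rangle$ is a realizer of $f$, where $\langle\cdot,\cdot\rangle$ is a standard computable pairing on $\mathbb N^{\mathbb N}$. $\equiv_W$ is the induced equivalence. $\mathcal A_-(\mathbb N)$ is the set of subsets of $\mathbb N$, where $p$ names $A$ iff $\mathbb N\setminus A=\{n:n+1\in\mathrm{range}(p)\}$; $\mathsf{C_{\mathbb N}}:\subseteq\mathcal A_-(\mathbb N)\rightrightarrows\mathbb N$, $A\mapsto A$, on non-empty $A$. A computable Banach space is a (real) Banach space together with a sequence whose linear span is dense, such that the induced metric space is a complete computable metric space; points are represented by the Cauchy representation $\delta_X$. $\mathcal C(X,Y)$ is the space of continuous $T:X\to Y$ with the function space representation $[\delta_X\to\delta_Y]$. For a computable metric space $Z$,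 $\mathcal A_+(Z)$ is the set of closed subsets of $Z$ represented by positive information: a name of $A$ is an enumeration of all rational open balls that intersect $A$. $\ell^2$ is the standard computable Hilbert space. $\mathsf{CGT}_{X,Y}:\subseteq\mathcal A_+(X\times Y)\to\mathcal C(X,Y)$, $\mathrm{graph}(T)\mapsto T$, defined on those closed $A\subseteq X\times Y$ with $A=\mathrm{graph}(T)$ for some linear bounded $T:X\to Y$. *)

(* Defs.v *)
From Stdlib Require Import Reals Lra Lia List QArith Cantor.
From Coquelicot Require Import Coquelicot.
Import ListNotations.
Open Scope R_scope.

Definition Baire := nat -> nat.

Definition npair (a b : nat) : nat := Cantor.to_nat (a, b).
Definition nfst (n : nat) : nat := fst (Cantor.of_nat n).
Definition nsnd (n : nat) : nat := snd (Cantor.of_nat n).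

Fixpoint enc_list (l : list nat) : nat :=
  match l with
  | [] => 0%nat
  | a :: l' => S (npair a (enc_list l'))
  end.

Fixpoint dec_list_fuel (fuel n : nat) : list nat :=
  match fuel with
  | O => []
  | S fuel' =>
      match n with
      | O => []
      | S m => nfst m :: dec_list_fuel fuel' (nsnd m)
      end
  end.
Definition dec_list (n : nat) : list nat := dec_list_fuel n n.

Definition dec_Z (n : nat) : Z :=
  if Nat.even n then Z.of_nat (Nat.div2 n) else (- Z.of_nat (S (Nat.div2 n)))%Z.
Definition dec_Q (n : nat) : Q := Qmake (dec_Z (nfst n)) (Pos.of_succ_nat (nsnd n)).

Definition pairB (p q : Baire) : Baire :=
  fun n => if Nat.even n then p (Nat.div2 n) else q (Nat.div2 n).

Definition prefix (p : Baire) (k : nat) : list nat := map p (seq 0 k).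

Inductive PR : Type :=
| PZero : PR
| PSucc : PR
| PProj : nat -> PR
| PComp : PR -> list PR -> PR
| PPrim : PR -> PR -> PR
| PMin : PR -> PR.

Inductive evalPR : PR -> list nat -> nat -> Prop :=
| ev_zero xs : evalPR PZero xs 0
| ev_succ x xs : evalPR PSucc (x :: xs) (S x)
| ev_proj i xs : (i < length xs)%nat -> evalPR (PProj i) xs (nth i xs 0%nat)
| ev_comp f gs xs ys y :
    evalsPR gs xs ys -> evalPR f ys y -> evalPR (PComp f gs) xs y
| ev_prim0 f g xs y : evalPR f xs y -> evalPR (PPrim f g) (0%nat :: xs) y
| ev_primS f g n xs r y :
    evalPR (PPrim f g) (n :: xs) r -> evalPR g (n :: r :: xs) y ->
    evalPR (PPrim f g) (S n :: xs) y
| ev_min f xs n :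
    evalPR f (n :: xs) 0 ->
    (forall m, (m < n)%nat -> exists v, evalPR f (m :: xs) (S v)) ->
    evalPR (PMin f) xs n
with evalsPR : list PR -> list nat -> list nat -> Prop :=
| evs_nil xs : evalsPR [] xs []
| evs_cons g gs xs y ys :
    evalPR g xs y -> evalsPR gs xs ys -> evalsPR (g :: gs) xs (y :: ys).

Definition computable_nat (f : nat -> nat) : Prop :=
  exists c : PR, forall n, evalPR c [n] (f n).

(* The partial continuous function F_h : Baire -> Baire given by the
   (Kleene) associate h : nat -> nat, as a (functional) relation.
   F_h(p)(n) = m  iff  h(<n, p[0..k)>) = m+1 for the least k with
   h(<n, p[0..k)>) <> 0.  Computable partial functions on Baire space are
   exactly the restrictions of F_h with h computable. *)
Definition assoc_eval (h : nat -> nat) (p q : Baire) : Prop :=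
  forall n, exists k,
    (forall j, (j < k)%nat -> h (npair n (enc_list (prefix p j))) = 0%nat) /\
    h (npair n (enc_list (prefix p k))) = S (q n).

Record RepSpace := {
  rs_car : Type;
  rs_name : Baire -> rs_car -> Prop
}.

(* realizer of a partial multivalued map f : X =>> Y (given as a relation;
   dom f = { x | exists y, f x y }); the realizer F is a partial function on
   Baire space given as a (functional) relation *)
Definition realizer {X Y : RepSpace} (f : rs_car X -> rs_car Y -> Prop)
  (F : Baire -> Baire -> Prop) : Prop :=
  forall p x, rs_name X p x -> (exists y, f x y) ->
    exists q, F p q /\ exists y, rs_name Y q y /\ f x y.

Definition weihrauch_le {X Y Z W : RepSpace}
  (f : rs_car X -> rs_car Y -> Prop) (g : rs_car Z -> rs_car W -> Prop) : Prop :=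
  exists h k : nat -> nat,
    computable_nat h /\ computable_nat k /\
    forall G : Baire -> option Baire,
      realizer g (fun p q => G p = Some q) ->
      realizer f (fun p s => exists q r,
                     assoc_eval k p q /\ G q = Some r /\
                     assoc_eval h (pairB p r) s).

Definition weihrauch_eq {X Y Z W : RepSpace}
  (f : rs_car X -> rs_car Y -> Prop) (g : rs_car Z -> rs_car W -> Prop) : Prop :=
  weihrauch_le f g /\ weihrauch_le g f.

Definition NatRep : RepSpace := {| rs_car := nat; rs_name := fun p n => p 0%nat = n |}.

Definition AMinusN : RepSpace :=
  {| rs_car := nat -> Prop;
     rs_name := fun p A => forall n, ~ A n <-> exists k, p k = S n |}.

(* C_N : A_-(N) =>> N, A |-> A, defined on non-empty A *)
Definition C_N : rs_car AMinusN -> rs_car NatRep -> Prop := fun A n => A n.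

Record BanachData := {
  bcar : Type;
  bzero : bcar;
  badd : bcar -> bcar -> bcar;
  bscal : R -> bcar -> bcar;
  bnorm : bcar -> R;
  bseq : nat -> bcar   (* the sequence whose linear span is dense *)
}.

Section BanachDefs.
Variable X : BanachData.

Definition bdist (x y : bcar X) : R := bnorm X (badd X x (bscal X (-1) y)).

Fixpoint comb_from (k : nat) (l : list R) : bcar X :=
  match l with
  | [] => bzero X
  | c :: l' => badd X (bscal X c (bseq X k)) (comb_from (S k) l')
  end.

(* the dense sequence of the computable metric space: rational linear
   combinations of the e_i *)
Definition alpha (n : nat) : bcar X := comb_from 0 (map (fun m => Q2R (dec_Q m)) (dec_list n)).

Definition is_banach_space : Prop :=
  (forall x y z, badd X x (badd X y z) = badd X (badd X x y) z) /\
  (forall x y, badd X x y = badd X y x) /\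
  (forall x, badd X (bzero X) x = x) /\
  (forall x, badd X x (bscal X (-1) x) = bzero X) /\
  (forall x, bscal X 1 x = x) /\
  (forall a b x, bscal X a (bscal X b x) = bscal X (a * b) x) /\
  (forall a b x, bscal X (a + b) x = badd X (bscal X a x) (bscal X b x)) /\
  (forall a x y, bscal X a (badd X x y) = badd X (bscal X a x) (bscal X a y)) /\
  (forall x, bnorm X x = 0 -> x = bzero X) /\
  (forall a x, bnorm X (bscal X a x) = Rabs a * bnorm X x) /\
  (forall x y, bnorm X (badd X x y) <= bnorm X x + bnorm X y) /\
  (forall u : nat -> bcar X,
      (forall eps, 0 < eps -> exists N, forall m n, (N <= m)%nat -> (N <= n)%nat ->
          bdist (u m) (u n) < eps) ->
      exists x, forall eps, 0 < eps -> exists N, forall n, (N <= n)%nat ->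
          bdist (u n) x < eps).

Definition is_computable_banach_space : Prop :=
  is_banach_space /\
  (forall x eps, 0 < eps -> exists l : list R, bdist (comb_from 0 l) x < eps) /\
  (exists f : nat -> nat, computable_nat f /\
     forall i j k, Rabs (bdist (alpha i) (alpha j) - Q2R (dec_Q (f (npair (npair i j) k))))
                   <= (/ 2) ^ k).

Definition cauchy_name (p : Baire) (x : bcar X) : Prop :=
  forall n, bdist (alpha (p n)) x <= (/ 2) ^ n.

Definition linear_bounded {Y : BanachData} (T : bcar X -> bcar Y) : Prop :=
  (forall x y, T (badd X x y) = badd Y (T x) (T y)) /\
  (forall a x, T (bscal X a x) = bscal Y a (T x)) /\
  (exists C, forall x, bnorm Y (T x) <= C * bnorm X x).

End BanachDefs.

Definition prod_dist (X Y : BanachData) (z w : bcar X * bcar Y) : R :=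
  Rmax (bdist X (fst z) (fst w)) (bdist Y (snd z) (snd w)).

(* rational open ball with code n: centre (alpha X i, alpha Y j), radius q,
   where n = <<i, j>, q>; balls with radius <= 0 are empty *)
Definition ball_center (X Y : BanachData) (n : nat) : bcar X * bcar Y :=
  (alpha X (nfst (nfst n)), alpha Y (nsnd (nfst n))).
Definition ball_radius (n : nat) : R := Q2R (dec_Q (nsnd n)).

Definition prod_closed (X Y : BanachData) (A : bcar X * bcar Y -> Prop) : Prop :=
  forall z, (forall eps, 0 < eps -> exists w, A w /\ prod_dist X Y z w < eps) -> A z.

Definition APlus (X Y : BanachData) : RepSpace :=
  {| rs_car := bcar X * bcar Y -> Prop;
     rs_name := fun p A =>
       prod_closed X Y A /\
       forall n, (exists k, p k = S n) <->
                 exists z, A z /\ prod_dist X Y z (ball_center X Y n) < ball_radius n |}.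

Definition CFun (X Y : BanachData) : RepSpace :=
  {| rs_car := bcar X -> bcar Y;
     rs_name := fun p T =>
       forall q x, cauchy_name X q x ->
         exists r, assoc_eval p q r /\ cauchy_name Y r (T x) |}.

Definition CGT (X Y : BanachData) : rs_car (APlus X Y) -> rs_car (CFun X Y) -> Prop :=
  fun A T => linear_bounded X T /\ forall x y, A (x, y) <-> T x = y.

Definition l2car : Type := { x : nat -> R | ex_series (fun n => (x n) ^ 2) }.

Lemma l2_zero_ok : ex_series (fun n : nat => (0 : R) ^ 2).
Proof.
  apply ex_series_ext with (fun _ => 0).
  - intros; simpl; ring.
  - apply ex_series_ext with (fun n => (/2) ^ n * 0).
    + intros n; apply Rmult_0_r.
    + apply ex_series_scal_r. apply ex_series_geom.
      rewrite Rabs_right; lra.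
Qed.

Lemma l2_scal_ok (a : R) (x : l2car) :
  ex_series (fun n => (a * proj1_sig x n) ^ 2).
Proof.
  destruct x as [x Hx]; simpl.
  apply ex_series_ext with (fun n => (x n) ^ 2 * a ^ 2).
  - intros n. change (x n ^ 2 * a ^ 2 = (a * x n) ^ 2). ring.
  - apply ex_series_scal_r. exact Hx.
Qed.

Lemma l2_add_ok (x y : l2car) :
  ex_series (fun n => (proj1_sig x n + proj1_sig y n) ^ 2).
Proof.
  destruct x as [x Hx]; destruct y as [y Hy]; simpl.
  apply (@ex_series_le R_AbsRing R_CompleteNormedModule _ (fun n => (x n) ^ 2 * 2 + (y n) ^ 2 * 2)).
  - intros n. change (Rabs ((x n + y n) ^ 2) <= x n ^ 2 * 2 + y n ^ 2 * 2).
    rewrite Rabs_right.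
    + pose proof (pow2_ge_0 (x n - y n)). simpl in *. nra.
    + apply Rle_ge. apply pow2_ge_0.
  - apply (@ex_series_plus R_AbsRing R_NormedModule (fun n => x n ^ 2 * 2) (fun n => y n ^ 2 * 2));
      apply ex_series_scal_r; assumption.
Qed.

Lemma l2_unit_ok (k : nat) :
  ex_series (fun n : nat => (if Nat.eqb n k then 1 else 0) ^ 2).
Proof.
  apply (ex_series_incr_n _ (S k)).
  apply ex_series_ext with (fun _ => 0).
  - intros n. replace (Nat.eqb (S k + n) k) with false.
    + simpl; ring.
    + symmetry; apply PeanoNat.Nat.eqb_neq. lia.
  - apply ex_series_ext with (fun n => (/2) ^ n * 0).
    + intros n; apply Rmult_0_r.
    + apply ex_series_scal_r. apply ex_series_geom.
      rewrite Rabs_right; lra.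
Qed.

Definition l2 : BanachData :=
  {| bcar := l2car;
     bzero := exist _ (fun _ => 0) l2_zero_ok;
     badd := fun x y => exist _ (fun n => proj1_sig x n + proj1_sig y n) (l2_add_ok x y);
     bscal := fun a x => exist _ (fun n => a * proj1_sig x n) (l2_scal_ok a x);
     bnorm := fun x => sqrt (Series (fun n => (proj1_sig x n) ^ 2));
     bseq := fun k => exist _ (fun n => if Nat.eqb n k then 1 else 0) (l2_unit_ok k) |}.

(* Main.v *)
(** CGT <= C_N: positive information on the graph of T semidecides that n is not a bound of T,
    because a ball with centre (a, b) and radius r that meets the graph refutes n as soon as
    n (|a| + r) < |b| - r.  So C_N supplies a bound n; given it, a small ball around (a, b)
    meeting the graph with a close to x determines T x up to n (|x - a| + r) + r.

    C_N <= CGT on l2: guess the least element that has not been excluded yet, g(0) <= g(1) <= ...,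
    with limit G in the given set, and let T map e_0 to G e_0 and e_(k+1) to
    2^k (g(k) - g(k+1)) e_0.  Almost all g(k) - g(k+1) vanish, so T is bounded.  It maps
    e_0 + sum_(k >= m) 2^-k e_(k+1) to g(m) e_0, so a dense sequence of the graph is computable
    from g although T e_0 is not; evaluating T at e_0 with precision 1/4 reveals G. *)

From Stdlib Require Import Reals Lra Lia List QArith Cantor.
From Stdlib Require Import FunctionalExtensionality ProofIrrelevance ConstructiveEpsilon Classical.
From Coquelicot Require Import Coquelicot.
Require Import Defs.
Import ListNotations.

Open Scope nat_scope.

(** * Closure properties of computable functions *)

(** What positive information on a graph withholds is only a modulus of continuity, and for linear T
    this is a single number whose failures can be enumerated; hence one use of C_N is enough. The
    search for a good ball is left to whoever runs the associate that is produced as a name of T. So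
    both functionals of the first reduction read an amount of input that is known in advance for
    each output entry.

    In the converse reduction the weights 2^k and 2^-k answer two opposite demands. The correcting
    vectors have to be small, so that an open ball around a rational vector still contains the
    corrected vector; but their images have to move the value by the whole number g(k) - g(k+1). The
    price is that the norm of T depends on how late g changes. This cannot be avoided: a bound
    computed from g would, by the first reduction, make lim g computable. *)

Definition computable2 (f : nat -> nat -> nat) : Prop :=
  exists c, forall x y, evalPR c [x; y] (f x y).
Definition computable3 (f : nat -> nat -> nat -> nat) : Prop :=
  exists c, forall x y z, evalPR c [x; y; z] (f x y z).

Lemma evalPR_proj i xs y : nth_error xs i = Some y -> evalPR (PProj i) xs y.
Proof.
  intros H. rewrite <- (nth_error_nth xs i 0 H). constructor.
  apply nth_error_Some. congruence.
Qed.

Lemma computable_ext f g : (forall x, f x = g x) -> computable_nat f -> computable_nat g.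
Proof. intros E [c Hc]. exists c. intros n. rewrite <- E. apply Hc. Qed.

Lemma computable_id : computable_nat (fun x => x).
Proof. exists (PProj 0). intros n. now apply evalPR_proj. Qed.

Lemma computable_comp1 f a :
  computable_nat f -> computable_nat a -> computable_nat (fun x => f (a x)).
Proof.
  intros [cf Hf] [ca Ha]. exists (PComp cf [ca]). intros n.
  eapply ev_comp; [repeat econstructor; apply Ha | apply Hf].
Qed.

Lemma computable_comp2 f a b :
  computable2 f -> computable_nat a -> computable_nat b ->
  computable_nat (fun x => f (a x) (b x)).
Proof.
  intros [cf Hf] [ca Ha] [cb Hb]. exists (PComp cf [ca; cb]). intros n.
  eapply ev_comp; [econstructor; [apply Ha|econstructor; [apply Hb|constructor]] | apply Hf].
Qed.

Lemma computable_S a : computable_nat a -> computable_nat (fun x => S (a x)).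
Proof.
  apply (computable_comp1 S). exists PSucc. constructor.
Qed.

Lemma computable_const k : computable_nat (fun _ => k).
Proof.
  induction k; [|now apply computable_S]. exists PZero. constructor.
Qed.

(** Recursions on numbers are written with this one scheme, so that [computable_prec] lets proof
    search find their programs; [Nat.even], [Nat.div2] and [dec_list] get counterparts of this
    form. *)
Definition prec (a : nat) (g : nat -> nat -> nat) : nat -> nat :=
  fix rec n := match n with O => a | S k => g k (rec k) end.

Lemma prec_computable2 a g :
  computable_nat a -> computable3 (fun k r x => g x k r) ->
  computable2 (fun n x => prec (a x) (g x) n).
Proof.
  intros [ca Ha] [cg Hg]. exists (PPrim ca cg). intros n x.
  induction n; simpl; econstructor; [apply Ha | eassumption | apply Hg].
Qed.

Lemma prec_computable0 a g : computable2 g -> computable_nat (prec a g).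
Proof.
  intros [cg Hg]. destruct (computable_const a) as [ca Ha].
  (* A unary [PPrim] runs its base program on the empty list, where the unary programs for constants
     say nothing. *)
  assert (Hnil : exists c, evalPR c [] a).
  { clear. induction a as [|a [c Hc]]; [exists PZero; constructor|].
    exists (PComp PSucc [c]). eapply ev_comp; repeat econstructor; eassumption. }
  destruct Hnil as [c0 H0]. exists (PPrim c0 cg). intros n.
  induction n; simpl; econstructor; [apply H0 | eassumption | apply Hg].
Qed.

Lemma computable2_add : computable2 Nat.add.
Proof.
  destruct (prec_computable2 (fun x => x) (fun _ _ r => S r)) as [c Hc].
  - apply computable_id.
  - exists (PComp PSucc [PProj 1]). intros k r x.
    eapply ev_comp; [repeat econstructor; now apply evalPR_proj | constructor].
  - exists c. intros x y. replace (x + y) with (prec y (fun _ r => S r) x); [apply Hc|].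
    induction x; simpl; congruence.
Qed.

Lemma computable_pred a : computable_nat a -> computable_nat (fun x => Nat.pred (a x)).
Proof.
  apply computable_comp1. eapply computable_ext; [|apply (prec_computable0 0 (fun k _ => k))].
  - now intros [|x].
  - exists (PProj 0). intros; now apply evalPR_proj.
Qed.

Lemma computable2_sub : computable2 Nat.sub.
Proof.
  destruct (prec_computable2 (fun x => x) (fun _ _ r => Nat.pred r)) as [c Hc].
  - apply computable_id.
  - destruct (computable_pred _ computable_id) as [c Hc].
    exists (PComp c [PProj 1]). intros k r x.
    eapply ev_comp; [repeat econstructor; now apply evalPR_proj | apply Hc].
  - exists (PComp c [PProj 1; PProj 0]). intros x y.
    eapply ev_comp; [repeat econstructor; now apply evalPR_proj|].
    replace (x - y) with (prec x (fun _ r => Nat.pred r) y); [apply Hc|].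
    induction y; simpl; lia.
Qed.

Lemma computable2_mul : computable2 Nat.mul.
Proof.
  destruct (prec_computable2 (fun x => 0) (fun x _ r => x + r)) as [c Hc].
  - apply computable_const.
  - destruct computable2_add as [c Hc].
    exists (PComp c [PProj 2; PProj 1]). intros k r x.
    eapply ev_comp; [repeat econstructor; now apply evalPR_proj | apply Hc].
  - exists c. intros x y. replace (x * y) with (prec 0 (fun _ r => y + r) x); [apply Hc|].
    induction x; simpl; lia.
Qed.

Lemma computable_add a b :
  computable_nat a -> computable_nat b -> computable_nat (fun x => a x + b x).
Proof. apply (computable_comp2 _ _ _ computable2_add). Qed.

Lemma computable_sub a b :
  computable_nat a -> computable_nat b -> computable_nat (fun x => a x - b x).
Proof. apply (computable_comp2 _ _ _ computable2_sub). Qed.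

Lemma computable_mul a b :
  computable_nat a -> computable_nat b -> computable_nat (fun x => a x * b x).
Proof. apply (computable_comp2 _ _ _ computable2_mul). Qed.

Definition tri (n : nat) : nat := prec 0 (fun k r => S k + r) n.

Lemma computable_tri a : computable_nat a -> computable_nat (fun x => tri (a x)).
Proof.
  apply computable_comp1. apply prec_computable0.
  destruct computable2_add as [c Hc].
  exists (PComp c [PComp PSucc [PProj 0]; PProj 1]). intros k r.
  eapply ev_comp; [|apply Hc]. econstructor.
  - eapply ev_comp; [repeat econstructor; now apply evalPR_proj | constructor].
  - repeat econstructor; now apply evalPR_proj.
Qed.

Lemma tri_double n : 2 * tri n = n * S n.
Proof.
  induction n as [|n IH]; [reflexivity|].
  change (tri (S n)) with (S n + tri n). nia.
Qed.

(** Brings the pairing into primitive recursive form; its bounds and its monotonicity are read off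
    from this form too. *)
Lemma npair_tri x y : npair x y = y + tri (x + y).
Proof.
  pose proof (Cantor.to_nat_spec x y). pose proof (tri_double (x + y)).
  unfold npair. nia.
Qed.

Lemma nfst_npair x y : nfst (npair x y) = x.
Proof. unfold nfst, npair. now rewrite Cantor.cancel_of_to. Qed.

Lemma nsnd_npair x y : nsnd (npair x y) = y.
Proof. unfold nsnd, npair. now rewrite Cantor.cancel_of_to. Qed.

Lemma npair_surj n : npair (nfst n) (nsnd n) = n.
Proof. unfold npair, nfst, nsnd. rewrite <- surjective_pairing. apply Cantor.cancel_to_of. Qed.

Ltac unpair := repeat first [rewrite nfst_npair | rewrite nsnd_npair].

Lemma computable2_npair : computable2 npair.
Proof.
  destruct computable2_add as [c Hc]. destruct (computable_tri _ computable_id) as [t Ht].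
  exists (PComp c [PProj 1; PComp t [PComp c [PProj 0; PProj 1]]]). intros x y.
  rewrite npair_tri. eapply ev_comp; [|apply Hc].
  econstructor; [now apply evalPR_proj|]. econstructor; [|constructor].
  eapply ev_comp; [|apply Ht]. econstructor; [|constructor].
  eapply ev_comp; [|apply Hc]. repeat econstructor; now apply evalPR_proj.
Qed.

Lemma computable_npair a b :
  computable_nat a -> computable_nat b -> computable_nat (fun x => npair (a x) (b x)).
Proof. apply (computable_comp2 _ _ _ computable2_npair). Qed.

(** The result is a sigma type, so that functions can be defined from a mere existence statement;
    for a decidable predicate this needs no choice axiom. *)
Lemma least_nat (P : nat -> Prop) (dec : forall n, {P n} + {~ P n}) :
  (exists n, P n) -> {n | P n /\ forall m, m < n -> ~ P m}.
Proof.
  intros H. destruct (epsilon_smallest P dec H) as [n [Hn Hm]]. exists n. split; [exact Hn|].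
  intros m Hlt Pm. specialize (Hm m Pm). lia.
Qed.

Lemma computable_min (g : nat -> nat -> nat) :
  computable2 (fun n x => g x n) -> (forall x, exists n, g x n = 0) ->
  exists f, computable_nat f /\ forall x, g x (f x) = 0 /\ forall m, m < f x -> g x m <> 0.
Proof.
  intros [c Hc] H.
  set (s := fun x => least_nat _ (fun n => Nat.eq_dec (g x n) 0) (H x)).
  exists (fun x => proj1_sig (s x)). split.
  - exists (PMin c). intros x. destruct (s x) as [n [H0 Hm]]; simpl. constructor.
    + rewrite <- H0. apply Hc.
    + intros m Hlt. exists (Nat.pred (g x m)). specialize (Hm m Hlt).
      replace (S (Nat.pred (g x m))) with (g x m) by lia. apply Hc.
  - intros x. destruct (s x) as [n Hn]. exact Hn.
Qed.

(* The Cantor pairing enumerates diagonals: [nfst n + nsnd n] is the least [w] with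
   [n < tri (S w)]. *)
Lemma computable_nfst_nsnd : computable_nat nfst /\ computable_nat nsnd.
Proof.
  destruct (computable_min (fun x w => S x - tri (S w))) as (f & Hf & Hspec).
  - destruct computable2_sub as [c Hc].
    destruct (computable_tri _ (computable_S _ computable_id)) as [t Ht].
    exists (PComp c [PComp PSucc [PProj 1]; PComp t [PProj 0]]). intros n x.
    eapply ev_comp; [|apply Hc]. econstructor.
    + eapply ev_comp; [repeat econstructor; now apply evalPR_proj | constructor].
    + econstructor; [|constructor].
      eapply ev_comp; [repeat econstructor; now apply evalPR_proj | apply Ht].
  - intros x. exists x. pose proof (tri_double (S x)). nia.
  - assert (E : forall n, f n = nfst n + nsnd n).
    { intros n. destruct (Hspec n) as [H0 Hm].
      rewrite <- (npair_surj n) in H0 at 1. rewrite npair_tri in H0.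
      pose proof (tri_double (S (f n))). pose proof (tri_double (nfst n + nsnd n)).
      destruct (Nat.lt_trichotomy (f n) (nfst n + nsnd n)) as [L|[L|L]]; [nia|exact L|].
      exfalso. apply (Hm _ L). rewrite <- (npair_surj n) at 1. rewrite npair_tri.
      pose proof (tri_double (S (nfst n + nsnd n))). nia. }
    assert (E2 : forall n, n - tri (f n) = nsnd n).
    { intros n. rewrite E. rewrite <- (npair_surj n) at 1. rewrite npair_tri. lia. }
    assert (H2 : computable_nat nsnd).
    { eapply computable_ext; [exact E2|].
      apply computable_sub; [apply computable_id | now apply computable_tri]. }
    split; [|exact H2].
    apply (computable_ext (fun n => f n - nsnd n)); [intros n; rewrite E; lia|].
    now apply computable_sub.
Qed.

Lemma computable_nfst a : computable_nat a -> computable_nat (fun x => nfst (a x)).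
Proof. apply computable_comp1, computable_nfst_nsnd. Qed.

Lemma computable_nsnd a : computable_nat a -> computable_nat (fun x => nsnd (a x)).
Proof. apply computable_comp1, computable_nfst_nsnd. Qed.

(** The proof search below knows unary goals only, so functions of several arguments are reduced to
    unary ones. *)
Lemma computable2_unpair g :
  computable_nat (fun z => g (nfst z) (nsnd z)) -> computable2 g.
Proof.
  intros [c Hc]. destruct computable2_npair as [p Hp].
  exists (PComp c [p]). intros x y.
  eapply ev_comp; [econstructor; [apply Hp|constructor]|].
  specialize (Hc (npair x y)). now rewrite nfst_npair, nsnd_npair in Hc.
Qed.

Lemma computable3_unpair g :
  computable_nat (fun z => g (nfst z) (nfst (nsnd z)) (nsnd (nsnd z))) -> computable3 g.
Proof.
  intros [c Hc]. destruct computable2_npair as [p Hp].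
  exists (PComp c [PComp p [PProj 0; PComp p [PProj 1; PProj 2]]]). intros x y z.
  eapply ev_comp.
  - econstructor; [|constructor]. eapply ev_comp; [|apply Hp].
    econstructor; [now apply evalPR_proj|]. econstructor; [|constructor].
    eapply ev_comp; [|apply Hp]. repeat econstructor; now apply evalPR_proj.
  - specialize (Hc (npair x (npair y z))).
    now rewrite ?nfst_npair, ?nsnd_npair, ?nfst_npair, ?nsnd_npair in Hc.
Qed.

(** In the second premise [z] packs the counter, the previous value and the parameter, in this
    order, so that the premise is again a unary goal. *)
Lemma computable_prec a g m :
  computable_nat a ->
  computable_nat (fun z => g (nsnd (nsnd z)) (nfst z) (nfst (nsnd z))) ->
  computable_nat m ->
  computable_nat (fun x => prec (a x) (g x) (m x)).
Proof.
  intros Ha Hg Hm.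
  apply (computable_comp2 (fun n x => prec (a x) (g x) n) m (fun x => x));
    [|exact Hm|apply computable_id].
  apply prec_computable2; [exact Ha|]. now apply computable3_unpair.
Qed.

Create HintDb crec discriminated.
#[local] Hint Constants Opaque : crec.
#[local] Hint Resolve computable_id computable_const computable_S computable_pred computable_add
  computable_sub computable_mul computable_npair computable_nfst computable_nsnd
  computable_prec computable_tri : crec.

(* As a plain hint, [computable_comp1] would have to guess the outer function; here it is taken from
   a hypothesis. *)
#[local] Hint Extern 1 (computable_nat (fun x => _)) =>
  match goal with H : computable_nat ?f |- computable_nat (fun x => ?f _) =>
    apply (computable_comp1 f _ H) end : crec.

(** Tests such as [ltQ] return 0 for success, so the first branch is the successful one and a sum of
    tests is their conjunction. *)
Definition ifz (c a b : nat) : nat := match c with O => a | S _ => b end.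

Lemma computable_ifz c a b :
  computable_nat c -> computable_nat a -> computable_nat b ->
  computable_nat (fun x => ifz (c x) (a x) (b x)).
Proof.
  intros Hc Ha Hb. apply (computable_ext (fun x => prec (a x) (fun _ _ => b x) (c x))).
  - intros x. now destruct (c x).
  - auto 60 with crec.
Qed.

Definition parity (n : nat) : nat := prec 0 (fun _ r => 1 - r) n.
Definition half (n : nat) : nat := prec 0 (fun k r => r + parity k) n.
Definition npow (b n : nat) : nat := prec 1 (fun _ r => b * r) n.

Lemma computable_parity a : computable_nat a -> computable_nat (fun x => parity (a x)).
Proof. intros. unfold parity. auto 60 with crec. Qed.
#[local] Hint Resolve computable_ifz computable_parity : crec.

Lemma computable_half a : computable_nat a -> computable_nat (fun x => half (a x)).
Proof. intros. unfold half. auto 60 with crec. Qed.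

Lemma computable_npow a b :
  computable_nat a -> computable_nat b -> computable_nat (fun x => npow (a x) (b x)).
Proof. intros. unfold npow. auto 60 with crec. Qed.
#[local] Hint Resolve computable_half computable_npow : crec.

Lemma parity_half n : n = 2 * half n + parity n /\ parity n <= 1.
Proof.
  induction n as [|n IH]; [cbn; lia|].
  change (half (S n)) with (half n + parity n).
  change (parity (S n)) with (1 - parity n). lia.
Qed.

Lemma even_parity n : Nat.even n = (parity n =? 0).
Proof.
  destruct (parity_half n) as [E L].
  destruct (parity n) as [|[|k]]; [| |lia]; simpl Nat.eqb.
  - apply Nat.even_spec. exists (half n). lia.
  - rewrite <- Nat.negb_odd. replace (Nat.odd n) with true; [reflexivity|].
    symmetry. apply Nat.odd_spec. exists (half n). lia.
Qed.

Lemma div2_half n : Nat.div2 n = half n.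
Proof.
  destruct (parity_half n) as [E L]. rewrite Nat.div2_div.
  symmetry. apply (Nat.div_unique n 2 (half n) (parity n)); lia.
Qed.

Lemma npow_pos b n : 0 < b -> 0 < npow b n.
Proof. intros Hb. unfold npow. induction n; cbn [prec]; nia. Qed.

Lemma npow_INR b n : INR (npow b n) = (INR b ^ n)%R.
Proof. unfold npow. induction n; cbn [prec]; [reflexivity|]. rewrite mult_INR, IHn. reflexivity. Qed.

(** * Rational numbers and finite sequences as codes *)

Definition val (n : nat) : R := Q2R (dec_Q n).

(** A numerator is kept as a difference of naturals, at least one of which is 0; products and sums
    then avoid truncated subtraction until [mkQ]. *)
Definition qpos (n : nat) : nat := ifz (parity (nfst n)) (half (nfst n)) 0.
Definition qneg (n : nat) : nat := ifz (parity (nfst n)) 0 (S (half (nfst n))).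
Definition qden (n : nat) : nat := S (nsnd n).

Lemma val_fraction n : val n = ((INR (qpos n) - INR (qneg n)) / INR (qden n))%R.
Proof.
  unfold val, Q2R, dec_Q, qpos, qneg, qden, dec_Z. cbn [Qnum Qden].
  rewrite even_parity, div2_half. unfold Rdiv. f_equal.
  - destruct (parity (nfst n)); cbn [Nat.eqb]; cbn [ifz].
    + rewrite <- INR_IZR_INZ. simpl INR. lra.
    + rewrite opp_IZR, <- INR_IZR_INZ. change (INR 0) with 0%R. ring.
  - now rewrite INR_IZR_INZ.
Qed.

Lemma qden_pos n : (0 < INR (qden n))%R.
Proof. apply lt_0_INR. unfold qden. lia. Qed.

(* [2 * (a - b) + (2 * (b - a) - 1)] is the code under [dec_Z] of the integer a - b, one of
   the two truncated differences being 0. *)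
Definition mkQ (a b d : nat) : nat := npair (2 * (a - b) + (2 * (b - a) - 1)) (d - 1).

Lemma val_mkQ a b d : 0 < d -> val (mkQ a b d) = ((INR a - INR b) / INR d)%R.
Proof.
  intros Hd. unfold val, Q2R, dec_Q, mkQ. rewrite nfst_npair, nsnd_npair. cbn [Qnum Qden].
  unfold Rdiv. f_equal.
  - rewrite !INR_IZR_INZ, <- minus_IZR. f_equal. unfold dec_Z.
    rewrite even_parity, div2_half.
    set (e := 2 * (a - b) + (2 * (b - a) - 1)). destruct (parity_half e) as [E L].
    destruct (parity e) as [|[|]] eqn:P; cbn [Nat.eqb]; cbv iota; lia.
  - f_equal. rewrite INR_IZR_INZ. f_equal. lia.
Qed.

Lemma computable_mkQ a b d :
  computable_nat a -> computable_nat b -> computable_nat d ->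
  computable_nat (fun x => mkQ (a x) (b x) (d x)).
Proof. intros. unfold mkQ. auto 60 with crec. Qed.

Lemma computable_qpos a : computable_nat a -> computable_nat (fun x => qpos (a x)).
Proof. intros. unfold qpos. auto 60 with crec. Qed.
Lemma computable_qneg a : computable_nat a -> computable_nat (fun x => qneg (a x)).
Proof. intros. unfold qneg. auto 60 with crec. Qed.
Lemma computable_qden a : computable_nat a -> computable_nat (fun x => qden (a x)).
Proof. intros. unfold qden. auto 60 with crec. Qed.
#[local] Hint Resolve computable_mkQ computable_qpos computable_qneg computable_qden : crec.

Definition addQ (x y : nat) : nat :=
  mkQ (qpos x * qden y + qpos y * qden x) (qneg x * qden y + qneg y * qden x) (qden x * qden y).
Definition subQ (x y : nat) : nat :=
  mkQ (qpos x * qden y + qneg y * qden x) (qneg x * qden y + qpos y * qden x) (qden x * qden y).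
Definition mulQ (x y : nat) : nat :=
  mkQ (qpos x * qpos y + qneg x * qneg y) (qpos x * qneg y + qneg x * qpos y) (qden x * qden y).
Definition natQ (n : nat) : nat := mkQ n 0 1.
Definition halfpowQ (k : nat) : nat := mkQ 1 0 (npow 2 k).

(* 0 iff [val x < val y] *)
Definition ltQ (x y : nat) : nat :=
  S (qpos x * qden y + qneg y * qden x) - (qpos y * qden x + qneg x * qden y).

Lemma val_addQ x y : val (addQ x y) = (val x + val y)%R.
Proof.
  unfold addQ. rewrite val_mkQ by (unfold qden; lia). rewrite !val_fraction, !plus_INR, !mult_INR.
  pose proof (qden_pos x). pose proof (qden_pos y). field. lra.
Qed.

Lemma val_subQ x y : val (subQ x y) = (val x - val y)%R.
Proof.
  unfold subQ. rewrite val_mkQ by (unfold qden; lia). rewrite !val_fraction, !plus_INR, !mult_INR.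
  pose proof (qden_pos x). pose proof (qden_pos y). field. lra.
Qed.

Lemma val_mulQ x y : val (mulQ x y) = (val x * val y)%R.
Proof.
  unfold mulQ. rewrite val_mkQ by (unfold qden; lia). rewrite !val_fraction, !plus_INR, !mult_INR.
  pose proof (qden_pos x). pose proof (qden_pos y). field. lra.
Qed.

Lemma val_natQ n : val (natQ n) = INR n.
Proof. unfold natQ. rewrite val_mkQ by lia. simpl. lra. Qed.

Lemma val_halfpowQ k : val (halfpowQ k) = ((/ 2) ^ k)%R.
Proof.
  unfold halfpowQ. rewrite val_mkQ by (apply npow_pos; lia).
  rewrite npow_INR, pow_inv.
  change (INR 1) with 1%R. change (INR 0) with 0%R. change (INR 2) with 2%R. unfold Rdiv. ring.
Qed.

(** This makes 0 a sound default: past its end a coded list reads as zero coefficients, in agreement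
    with [alpha]. *)
Lemma val_0 : val 0 = 0%R.
Proof. rewrite val_fraction. cbn. lra. Qed.

Lemma ltQ_spec x y : ltQ x y = 0 <-> (val x < val y)%R.
Proof.
  pose proof (qden_pos x) as Hx. pose proof (qden_pos y) as Hy.
  transitivity (qpos x * qden y + qneg y * qden x < qpos y * qden x + qneg x * qden y).
  { unfold ltQ. lia. }
  rewrite !val_fraction. split; intros H.
  - apply lt_INR in H. rewrite !plus_INR, !mult_INR in H.
    apply (Rmult_lt_reg_r (INR (qden x) * INR (qden y))); [nra|].
    replace ((INR (qpos x) - INR (qneg x)) / INR (qden x) * (INR (qden x) * INR (qden y)))%R
      with ((INR (qpos x) - INR (qneg x)) * INR (qden y))%R by (field; lra).
    replace ((INR (qpos y) - INR (qneg y)) / INR (qden y) * (INR (qden x) * INR (qden y)))%R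
      with ((INR (qpos y) - INR (qneg y)) * INR (qden x))%R by (field; lra).
    lra.
  - apply INR_lt. rewrite !plus_INR, !mult_INR.
    apply (Rmult_lt_compat_r (INR (qden x) * INR (qden y))) in H; [|nra].
    replace ((INR (qpos x) - INR (qneg x)) / INR (qden x) * (INR (qden x) * INR (qden y)))%R
      with ((INR (qpos x) - INR (qneg x)) * INR (qden y))%R in H by (field; lra).
    replace ((INR (qpos y) - INR (qneg y)) / INR (qden y) * (INR (qden x) * INR (qden y)))%R
      with ((INR (qpos y) - INR (qneg y)) * INR (qden x))%R in H by (field; lra).
    lra.
Qed.

Section ComputableRationals.
Variables a b : nat -> nat.
Hypothesis Ha : computable_nat a.
Hypothesis Hb : computable_nat b.

Lemma computable_addQ : computable_nat (fun x => addQ (a x) (b x)).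
Proof. unfold addQ. auto 60 with crec. Qed.
Lemma computable_subQ : computable_nat (fun x => subQ (a x) (b x)).
Proof. unfold subQ. auto 60 with crec. Qed.
Lemma computable_mulQ : computable_nat (fun x => mulQ (a x) (b x)).
Proof. unfold mulQ. auto 60 with crec. Qed.
Lemma computable_ltQ : computable_nat (fun x => ltQ (a x) (b x)).
Proof. unfold ltQ. auto 60 with crec. Qed.
Lemma computable_natQ : computable_nat (fun x => natQ (a x)).
Proof. unfold natQ. auto 60 with crec. Qed.
Lemma computable_halfpowQ : computable_nat (fun x => halfpowQ (a x)).
Proof. unfold halfpowQ. auto 60 with crec. Qed.
End ComputableRationals.
#[local] Hint Resolve computable_addQ computable_subQ computable_mulQ computable_ltQ
  computable_natQ computable_halfpowQ : crec.

(** * Arithmetic on codes of finite sequences *)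

Definition ctl (n : nat) : nat := nsnd (Nat.pred n).
Definition cdrop (i n : nat) : nat := prec n (fun _ r => ctl r) i.
Definition cnth (n i : nat) : nat := nfst (Nat.pred (cdrop i n)).
(** Counts the nonempty drops; [n] rounds are enough since a list is no longer than its code. *)
Definition clen (n : nat) : nat := prec 0 (fun i r => r + ifz (cdrop i n) 0 1) n.

Lemma nsnd_le n : nsnd n <= n.
Proof. rewrite <- (npair_surj n) at 2. rewrite npair_tri. lia. Qed.

Lemma nfst_le n : nfst n <= n.
Proof.
  rewrite <- (npair_surj n) at 2. rewrite npair_tri. pose proof (tri_double (nfst n + nsnd n)). nia.
Qed.

Lemma dec_list_fuel_enough f f' n : n <= f -> n <= f' -> dec_list_fuel f n = dec_list_fuel f' n.
Proof.
  revert f' n. induction f as [|f IH]; intros [|f'] [|m] H H'; try reflexivity; try lia.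
  simpl. f_equal. apply IH; pose proof (nsnd_le m); lia.
Qed.

Lemma dec_list_S m : dec_list (S m) = nfst m :: dec_list (nsnd m).
Proof.
  unfold dec_list. simpl. f_equal. apply dec_list_fuel_enough; pose proof (nsnd_le m); lia.
Qed.

Lemma dec_enc_list l : dec_list (enc_list l) = l.
Proof.
  induction l as [|x l IH]; [reflexivity|].
  cbn [enc_list]. now rewrite dec_list_S, nfst_npair, nsnd_npair, IH.
Qed.

Lemma dec_list_length n : length (dec_list n) <= n.
Proof.
  induction n as [n IH] using (well_founded_induction Nat.lt_wf_0). destruct n as [|m]; [cbn; lia|].
  rewrite dec_list_S. simpl. pose proof (nsnd_le m). specialize (IH (nsnd m)). lia.
Qed.

Lemma dec_list_ctl n : dec_list (ctl n) = tl (dec_list n).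
Proof. destruct n; [reflexivity|]. now rewrite dec_list_S. Qed.

Lemma dec_list_cdrop i n : dec_list (cdrop i n) = skipn i (dec_list n).
Proof.
  induction i as [|i IH]; [reflexivity|].
  change (cdrop (S i) n) with (ctl (cdrop i n)). rewrite dec_list_ctl, IH.
  clear. generalize (dec_list n). induction i; intros [|x l]; try reflexivity. apply (IHi l).
Qed.

Lemma cnth_nth n i : cnth n i = nth i (dec_list n) 0.
Proof.
  unfold cnth. rewrite <- (firstn_skipn i (dec_list n)) at 1.
  transitivity (hd 0 (skipn i (dec_list n))).
  - rewrite <- dec_list_cdrop. destruct (cdrop i n); [reflexivity|]. now rewrite dec_list_S.
  - clear. generalize (dec_list n). induction i; intros [|x l]; try reflexivity. apply (IHi l).
Qed.

Lemma cnth_overflow n i : n <= i -> cnth n i = 0.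
Proof.
  intros H. rewrite cnth_nth. apply nth_overflow. pose proof (dec_list_length n). lia.
Qed.

Lemma cdrop_zero i n : cdrop i n = 0 <-> length (dec_list n) <= i.
Proof.
  rewrite skipn_all_iff, <- dec_list_cdrop.
  destruct (cdrop i n); [tauto|]. rewrite dec_list_S. split; discriminate.
Qed.

Lemma clen_length n : clen n = length (dec_list n).
Proof.
  unfold clen. pose proof (dec_list_length n) as L.
  assert (H : forall m, prec 0 (fun i r => r + ifz (cdrop i n) 0 1) m = Nat.min m (length (dec_list n))).
  { induction m as [|m IH]; [reflexivity|]. cbn [prec]. rewrite IH.
    pose proof (cdrop_zero m n). destruct (cdrop m n); cbn [ifz]; lia. }
  rewrite H. lia.
Qed.

Lemma computable_cnth a b :
  computable_nat a -> computable_nat b -> computable_nat (fun x => cnth (a x) (b x)).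
Proof. intros. unfold cnth, cdrop, ctl. auto 60 with crec. Qed.

Lemma computable_clen a : computable_nat a -> computable_nat (fun x => clen (a x)).
Proof. intros. unfold clen, cdrop, ctl. auto 60 with crec. Qed.
#[local] Hint Resolve computable_cnth computable_clen : crec.

Lemma prefix_length p k : length (prefix p k) = k.
Proof. unfold prefix. now rewrite length_map, length_seq. Qed.

Lemma prefix_nth p k i : i < k -> nth i (prefix p k) 0 = p i.
Proof.
  intros H. unfold prefix. rewrite nth_indep with (d' := p 0) by (rewrite length_map, length_seq; lia).
  rewrite map_nth, seq_nth; [reflexivity|lia].
Qed.

Lemma clen_prefix p k : clen (enc_list (prefix p k)) = k.
Proof. rewrite clen_length, dec_enc_list. apply prefix_length. Qed.

Lemma cnth_prefix p k i : i < k -> cnth (enc_list (prefix p k)) i = p i.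
Proof. intros. rewrite cnth_nth, dec_enc_list. now apply prefix_nth. Qed.

Lemma pairB_even p q i : pairB p q (2 * i) = p i.
Proof.
  unfold pairB. rewrite div2_half, even_parity. destruct (parity_half (2 * i)).
  replace (parity (2 * i)) with 0 by lia. cbn [Nat.eqb]. cbv iota. f_equal. lia.
Qed.

Lemma pairB_odd p q i : pairB p q (2 * i + 1) = q i.
Proof.
  unfold pairB. rewrite div2_half, even_parity. destruct (parity_half (2 * i + 1)).
  replace (parity (2 * i + 1)) with 1 by lia. cbn [Nat.eqb]. cbv iota. f_equal. lia.
Qed.

(** * Building associates *)

Lemma assoc_eval_intro h p :
  (forall n, exists k, h (npair n (enc_list (prefix p k))) <> 0) ->
  exists q, assoc_eval h p q /\
    forall n, exists k, h (npair n (enc_list (prefix p k))) = S (q n).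
Proof.
  intros H.
  (* [assoc_eval] needs the least informative prefix, but the second conclusion forgets minimality.
     To verify an associate it is then enough that some prefix gets an answer and that every answer
     is right. *)
  set (P := fun n k => h (npair n (enc_list (prefix p k))) <> 0).
  assert (dec : forall n k, {P n k} + {~ P n k}).
  { intros n k. unfold P. destruct (Nat.eq_dec (h (npair n (enc_list (prefix p k)))) 0); tauto. }
  set (s := fun n => least_nat (P n) (dec n) (H n)).
  exists (fun n => Nat.pred (h (npair n (enc_list (prefix p (proj1_sig (s n))))))).
  assert (Hs : forall n, P n (proj1_sig (s n)) /\ forall m, m < proj1_sig (s n) -> ~ P n m)
    by (intros n; exact (proj2_sig (s n))).
  unfold P in Hs. split; intros n; exists (proj1_sig (s n)); destruct (Hs n) as [H1 H2];
    cbv beta in *.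
  - split; [intros j Hj; apply NNPP, (H2 j Hj) | now rewrite Nat.succ_pred].
  - now rewrite Nat.succ_pred.
Qed.

(** The associate stays silent on prefixes shorter than [use n]; from then on the prefix, padded
    with zeros by [cnth], stands in for the whole oracle. *)
Lemma assoc_eval_bounded_use (use : nat -> nat) (out : nat -> Baire -> nat) p :
  (forall n p', (forall i, i < use n -> p i = p' i) -> out n p = out n p') ->
  assoc_eval (fun z => ifz (use (nfst z) - clen (nsnd z))
                           (S (out (nfst z) (cnth (nsnd z)))) 0)
    p (fun n => out n p).
Proof.
  intros Huse n. exists (use n). split.
  - intros j Hj. rewrite nfst_npair, nsnd_npair, clen_prefix.
    destruct (use n - j) eqn:E; [lia|reflexivity].
  - rewrite nfst_npair, nsnd_npair, clen_prefix, Nat.sub_diag. cbn [ifz]. f_equal.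
    symmetry. apply Huse. intros i Hi. now rewrite cnth_prefix.
Qed.

(** * Banach spaces and bounded operators *)

Open Scope R_scope.

Lemma val_dense c eps : 0 < eps -> exists n, Rabs (val n - c) < eps.
Proof.
  intros He. destruct (archimed_cor1 eps He) as (d & Hd & Hd0).
  set (z := up (c * INR d)). destruct (archimed (c * INR d)) as [H1 H2]. fold z in H1, H2.
  assert (0 < INR d) by (apply lt_0_INR; lia).
  exists (mkQ (Z.to_nat z) (Z.to_nat (- z)) d). rewrite val_mkQ by lia.
  assert (E : INR (Z.to_nat z) - INR (Z.to_nat (- z)) = IZR z).
  { rewrite !INR_IZR_INZ, <- minus_IZR. f_equal. lia. }
  rewrite E. replace (IZR z / INR d - c) with ((IZR z - c * INR d) * / INR d) by (field; lra).
  assert (0 < / INR d) by now apply Rinv_0_lt_compat.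
  rewrite Rabs_pos_eq; nra.
Qed.

Section BanachSpace.
Variable X : BanachData.
Hypothesis HX : is_banach_space X.
Declare Scope banach_scope.
Notation "x + y" := (badd X x y) : banach_scope.
Notation "a * x" := (bscal X a x) : banach_scope.
Delimit Scope banach_scope with B.

Lemma badd_assoc x y z : (x + (y + z) = (x + y) + z)%B.
Proof. destruct HX as (H & _). apply H. Qed.
Lemma badd_comm x y : (x + y = y + x)%B.
Proof. destruct HX as (_ & H & _). apply H. Qed.
Lemma badd_0_l x : (bzero X + x = x)%B.
Proof. destruct HX as (_ & _ & H & _). apply H. Qed.
Lemma badd_opp_r x : (x + (-1) * x = bzero X)%B.
Proof. destruct HX as (_ & _ & _ & H & _). apply H. Qed.
Lemma bscal_1 x : (1 * x = x)%B.
Proof. destruct HX as (_ & _ & _ & _ & H & _). apply H. Qed.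
Lemma bscal_assoc a b x : (a * (b * x) = (Rmult a b) * x)%B.
Proof. destruct HX as (_ & _ & _ & _ & _ & H & _). apply H. Qed.
Lemma bscal_add_l a b x : (Rplus a b * x = a * x + b * x)%B.
Proof. destruct HX as (_ & _ & _ & _ & _ & _ & H & _). apply H. Qed.
Lemma bscal_add_r a x y : (a * (x + y) = a * x + a * y)%B.
Proof. destruct HX as (_ & _ & _ & _ & _ & _ & _ & H & _). apply H. Qed.
Lemma bnorm_scal a x : bnorm X (a * x)%B = Rabs a * bnorm X x.
Proof. destruct HX as (_ & _ & _ & _ & _ & _ & _ & _ & _ & H & _). apply H. Qed.
Lemma bnorm_add x y : bnorm X (x + y)%B <= bnorm X x + bnorm X y.
Proof. destruct HX as (_ & _ & _ & _ & _ & _ & _ & _ & _ & _ & H & _). apply H. Qed.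
Lemma bnorm_eq_0 x : bnorm X x = 0 -> x = bzero X.
Proof. destruct HX as (_ & _ & _ & _ & _ & _ & _ & _ & H & _). apply H. Qed.

Lemma badd_0_r x : (x + bzero X = x)%B.
Proof. now rewrite badd_comm, badd_0_l. Qed.

Lemma badd_swap x y z w : ((x + y) + (z + w) = (x + z) + (y + w))%B.
Proof.
  rewrite <- !badd_assoc. f_equal. rewrite !badd_assoc. f_equal. apply badd_comm.
Qed.

Lemma bscal_0_l x : (0 * x = bzero X)%B.
Proof.
  rewrite <- (badd_opp_r x). rewrite <- (bscal_1 x) at 2. rewrite <- bscal_add_l.
  f_equal. ring.
Qed.

Lemma bnorm_0 : bnorm X (bzero X) = 0.
Proof. rewrite <- (bscal_0_l (bzero X)), bnorm_scal, Rabs_R0. ring. Qed.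

Lemma bnorm_nonneg x : 0 <= bnorm X x.
Proof.
  pose proof (bnorm_add x ((-1) * x)%B) as H.
  rewrite badd_opp_r, bnorm_0, bnorm_scal in H.
  rewrite Rabs_left in H; lra.
Qed.

Lemma bdist_refl x : bdist X x x = 0.
Proof. unfold bdist. rewrite badd_opp_r. apply bnorm_0. Qed.

Lemma bdist_nonneg x y : 0 <= bdist X x y.
Proof. apply bnorm_nonneg. Qed.

Lemma bdist_0_r x : bdist X x (bzero X) = bnorm X x.
Proof.
  unfold bdist. rewrite <- (bscal_0_l (bzero X)), bscal_assoc, Rmult_0_r, bscal_0_l.
  now rewrite badd_0_r.
Qed.

Lemma bdist_sym x y : bdist X x y = bdist X y x.
Proof.
  unfold bdist. transitivity (bnorm X ((-1) * (x + (-1) * y))%B).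
  - rewrite bnorm_scal, Rabs_left; lra.
  - rewrite bscal_add_r, bscal_assoc. replace (-1 * -1) with 1 by ring.
    now rewrite bscal_1, badd_comm.
Qed.

Lemma bdist_triangle x y z : bdist X x z <= bdist X x y + bdist X y z.
Proof.
  unfold bdist. eapply Rle_trans; [|apply bnorm_add]. right. f_equal.
  rewrite badd_swap, (badd_comm ((-1) * y)%B), (badd_swap x), badd_opp_r.
  rewrite badd_0_r. now rewrite badd_comm.
Qed.

Lemma bdist_eq_0 x y : bdist X x y = 0 -> x = y.
Proof.
  intros H. apply bnorm_eq_0 in H.
  rewrite <- (badd_0_r x), <- (badd_opp_r y), (badd_comm y), badd_assoc, H.
  now rewrite badd_0_l.
Qed.

Lemma bdist_add x y x' y' :
  bdist X (x + y)%B (x' + y')%B <= bdist X x x' + bdist X y y'.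
Proof.
  unfold bdist. rewrite bscal_add_r, badd_swap. apply bnorm_add.
Qed.

Lemma bdist_scal a b x : bdist X (a * x)%B (b * x)%B = Rabs (a - b) * bnorm X x.
Proof.
  unfold bdist. rewrite bscal_assoc, <- bscal_add_l, bnorm_scal. do 2 f_equal. ring.
Qed.

Lemma bnorm_le_dist x y : bnorm X x <= bnorm X y + bdist X x y.
Proof. rewrite <- !bdist_0_r. pose proof (bdist_triangle x y (bzero X)). lra. Qed.

Lemma comb_from_rational_approx l : forall k eps, 0 < eps ->
  exists ms, bdist X (comb_from X k (map val ms)) (comb_from X k l) < eps.
Proof.
  induction l as [|c l IH]; intros k eps He.
  - exists []. simpl. now rewrite bdist_refl.
  - destruct (IH (S k) (eps / 2)) as [ms Hms]; [lra|].
    pose proof (bnorm_nonneg (bseq X k)) as Hn.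
    (* The summand 1 keeps the divisor positive when [bseq X k] has norm 0. *)
    destruct (val_dense c (eps / 2 / (bnorm X (bseq X k) + 1))) as [m Hm].
    { apply Rdiv_lt_0_compat; lra. }
    exists (m :: ms). cbn [map comb_from].
    eapply Rle_lt_trans; [apply bdist_add|]. rewrite bdist_scal.
    apply (Rmult_lt_compat_r (bnorm X (bseq X k) + 1)) in Hm; [|lra].
    replace (eps / 2 / (bnorm X (bseq X k) + 1) * (bnorm X (bseq X k) + 1)) with (eps / 2)
      in Hm by (field; lra).
    pose proof (Rabs_pos (val m - c)). nra.
Qed.

(** Since the code 0 names the zero vector, approximate norms come from the approximate metric with
    0 as second index. *)
Lemma alpha_0 : alpha X 0 = bzero X.
Proof. reflexivity. Qed.

Lemma alpha_dense :
  (forall x eps, 0 < eps -> exists l, bdist X (comb_from X 0 l) x < eps) ->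
  forall x eps, 0 < eps -> exists n, bdist X (alpha X n) x < eps.
Proof.
  intros D x eps He. destruct (D x (eps / 2)) as [l Hl]; [lra|].
  destruct (comb_from_rational_approx l 0 (eps / 2)) as [ms Hms]; [lra|].
  exists (enc_list ms). unfold alpha. rewrite dec_enc_list.
  pose proof (bdist_triangle (comb_from X 0 (map val ms)) (comb_from X 0 l) x).
  unfold val in *. lra.
Qed.

End BanachSpace.

Section BoundedOperator.
Variables (X Y : BanachData).
Hypothesis HX : is_banach_space X.
Hypothesis HY : is_banach_space Y.
Variables (T : bcar X -> bcar Y) (C : R).
Hypothesis Tadd : forall x y, T (badd X x y) = badd Y (T x) (T y).
Hypothesis Tscal : forall a x, T (bscal X a x) = bscal Y a (T x).
Hypothesis Tbound : forall x, bnorm Y (T x) <= C * bnorm X x.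

Lemma bounded_operator_lipschitz x y : bdist Y (T x) (T y) <= C * bdist X x y.
Proof. unfold bdist. rewrite <- Tscal, <- Tadd. apply Tbound. Qed.

Lemma bounded_operator_graph_closed : prod_closed X Y (fun z => T (fst z) = snd z).
Proof.
  intros [x y] H. simpl. apply (bdist_eq_0 Y HY).
  destruct (Req_dec (bdist Y (T x) y) 0) as [E|E]; [exact E|exfalso].
  assert (P : 0 < bdist Y (T x) y) by (pose proof (bdist_nonneg Y HY (T x) y); lra).
  pose proof (Rabs_pos C) as HC.
  (* A graph point within e of (x, y) forces |T x - y| to be at most (|C| + 1) e, which contradicts
     this choice of e. *)
  destruct (H (bdist Y (T x) y / (Rabs C + 2))) as ([x' y'] & E' & Hd).
  { apply Rdiv_lt_0_compat; lra. }
  simpl in E'. unfold prod_dist in Hd. simpl in Hd.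
  pose proof (Rmax_l (bdist X x x') (bdist Y y y')).
  pose proof (Rmax_r (bdist X x x') (bdist Y y y')).
  pose proof (bdist_triangle Y HY (T x) (T x') y) as Ht. rewrite E' in Ht at 2.
  rewrite (bdist_sym Y HY y' y) in Ht.
  pose proof (bounded_operator_lipschitz x x') as Hl. pose proof (Rle_abs C).
  pose proof (bdist_nonneg X HX x x').
  set (e := bdist Y (T x) y / (Rabs C + 2)) in *.
  assert (Ee : bdist Y (T x) y = e * (Rabs C + 2)) by (unfold e; field; lra).
  nra.
Qed.

End BoundedOperator.

(** * Evaluating an operator with known bound from its graph *)

Lemma halfpow_small eps : 0 < eps -> exists k, (/ 2) ^ k < eps.
Proof.
  intros He. destruct (pow_lt_1_zero (/ 2)) with (y := eps) as [k Hk]; [|exact He|].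
  - rewrite Rabs_pos_eq; lra.
  - exists k. specialize (Hk k (le_n k)). apply Rle_lt_trans with (2 := Hk). apply Rle_abs.
Qed.

Lemma val_between eps : 0 < eps -> exists c, 0 < val c < eps.
Proof.
  intros He. destruct (val_dense (eps / 2) (eps / 2)) as [c Hc]; [lra|].
  exists c. apply Rabs_def2 in Hc. lra.
Qed.

Lemma assoc_bounded_use_computable (use : nat -> nat) (out : nat -> Baire -> nat) :
  computable_nat use -> computable_nat (fun z => out (nfst z) (cnth (nsnd z))) ->
  computable_nat (fun z => ifz (use (nfst z) - clen (nsnd z))
                           (S (out (nfst z) (cnth (nsnd z)))) 0)%nat.
Proof. intros. auto 60 with crec. Qed.

Section ClosedGraph.
Variables X Y : BanachData.
Hypothesis HX : is_computable_banach_space X.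
Hypothesis HY : is_computable_banach_space Y.
Variables fX fY : nat -> nat.
Hypothesis fX_computable : computable_nat fX.
Hypothesis fY_computable : computable_nat fY.
Hypothesis fX_spec : forall i j k,
  Rabs (bdist X (alpha X i) (alpha X j) - val (fX (npair (npair i j) k))) <= (/ 2) ^ k.
Hypothesis fY_spec : forall i j k,
  Rabs (bdist Y (alpha Y i) (alpha Y j) - val (fY (npair (npair i j) k))) <= (/ 2) ^ k.

Let BX : is_banach_space X := proj1 HX.
Let BY : is_banach_space Y := proj1 HY.

(* The ball [b] with centre (x, y) and radius r, meeting the graph of T, shows that n is not
   a bound of T as soon as n (|x| + r) < |y| - r; the norms are known up to 2^-k. *)
Definition refutes (b n k : nat) : nat :=
  ltQ (mulQ (natQ n)
        (addQ (fX (npair (npair (nfst (nfst b)) 0) k)) (addQ (halfpowQ k) (nsnd b))))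
      (subQ (fY (npair (npair (nsnd (nfst b)) 0) k)) (addQ (halfpowQ k) (nsnd b))).

(** [m] runs over triples of an index into the name, a candidate bound and a precision, so all
    attempts at refutation are dovetailed; 0 is the void entry of a name. *)
Definition nonbound (m : nat) (p : Baire) : nat :=
  ifz (p (nfst m)) 0
    (ifz (refutes (Nat.pred (p (nfst m))) (nfst (nsnd m)) (nsnd (nsnd m))) (S (nfst (nsnd m))) 0).

(* Input [x] is [npair m l] with l a prefix of a name of a point z; of the input [P], entry 1 is
   an operator bound N and the even entries name the graph. *)
Definition evaluate (x : nat) (P : Baire) : nat :=
  let l := nsnd x in
  let t := nfst (Nat.pred (clen l)) in
  let u := nsnd (Nat.pred (clen l)) in
  let b := Nat.pred (P (2 * t)%nat) in
  ifz (clen l) 0 (ifz (P (2 * t)%nat) 0 (ifz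
    (ltQ (addQ (mulQ (natQ (P 1%nat))
                (addQ (fX (npair (npair (cnth l u) (nfst (nfst b))) u))
                      (addQ (addQ (halfpowQ u) (halfpowQ u)) (nsnd b)))) (nsnd b))
         (halfpowQ (nfst x)))
    (S (nsnd (nfst b))) 0)).

Lemma nonbound_computable : computable_nat (fun z => nonbound (nfst z) (cnth (nsnd z))).
Proof. unfold nonbound, refutes. auto 60 with crec. Qed.

Lemma evaluate_computable : computable_nat (fun z => evaluate (nfst z) (cnth (nsnd z))).
Proof. unfold evaluate. cbv zeta. auto 60 with crec. Qed.

Variables (p : Baire) (A : bcar X * bcar Y -> Prop) (T : bcar X -> bcar Y).
Hypothesis p_names_A : rs_name (APlus X Y) p A.
Hypothesis T_bounded : linear_bounded X T.
Hypothesis A_graph : forall x y, A (x, y) <-> T x = y.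

Definition operator_bound (n : nat) : Prop := forall x, bnorm Y (T x) <= INR n * bnorm X x.

Lemma ball_meets_graph t b : p t = S b ->
  exists x, bdist X x (alpha X (nfst (nfst b))) < val (nsnd b) /\
            bdist Y (T x) (alpha Y (nsnd (nfst b))) < val (nsnd b).
Proof.
  intros Hb. destruct p_names_A as [_ H].
  destruct (proj1 (H b)) as ([x y] & Hz & Hd); [now exists t|].
  apply A_graph in Hz. subst y. exists x.
  unfold prod_dist, ball_center, ball_radius in Hd. simpl in Hd. fold (val (nsnd b)) in Hd.
  split; eapply Rle_lt_trans; try exact Hd; [apply Rmax_l | apply Rmax_r].
Qed.

(** Completeness of the positive information: by density some ball of radius [val r] with rational
    centre contains (x, T x), so it has to be listed. *)
Lemma small_ball_enumerated x r : 0 < val r ->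
  exists t i j, p t = S (npair (npair i j) r) /\
    bdist X (alpha X i) x < val r /\ bdist Y (alpha Y j) (T x) < val r.
Proof.
  intros Hr.
  destruct (alpha_dense X BX (proj1 (proj2 HX)) x (val r) Hr) as [i Hi].
  destruct (alpha_dense Y BY (proj1 (proj2 HY)) (T x) (val r) Hr) as [j Hj].
  destruct p_names_A as [_ H].
  destruct (proj2 (H (npair (npair i j) r))) as [t Ht].
  - exists (x, T x). split; [now apply A_graph|].
    unfold prod_dist, ball_center, ball_radius. unpair. simpl.
    rewrite (bdist_sym X BX), (bdist_sym Y BY). now apply Rmax_lub_lt.
  - now exists t, i, j.
Qed.

Lemma nonbound_spec n : ~ operator_bound n <-> exists m, nonbound m p = S n.
Proof.
  pose proof (pos_INR n) as Hn. split.
  - intros H. apply not_all_ex_not in H. destruct H as [x Hx]. apply Rnot_le_lt in Hx.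
    set (g := bnorm Y (T x) - INR n * bnorm X x). assert (Hg : 0 < g) by (unfold g; lra).
    (* With 2^-k < r, the approximate norm of the centre, its error and r add up to at most |x| + 4
       r; likewise the image side is at least |T x| - 4 r. The test succeeds once 4 r (n + 1) <
       g. *)
    destruct (val_between (g / (4 * (INR n + 1)))) as (r & Hr0 & Hr).
    { apply Rdiv_lt_0_compat; lra. }
    destruct (halfpow_small (val r) Hr0) as [k Hk].
    destruct (small_ball_enumerated x r Hr0) as (t & i & j & Ht & Hi & Hj).
    exists (npair t (npair n k)). unfold nonbound, refutes.
    unpair. rewrite Ht. cbn [ifz Nat.pred].
    unpair.
    match goal with |- ifz ?c _ _ = _ => assert (E : c = 0%nat) end; [|now rewrite E].
    apply ltQ_spec.
    rewrite val_mulQ, val_subQ, !val_addQ, val_natQ, val_halfpowQ.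
    pose proof (fX_spec i 0 k) as FX. pose proof (fY_spec j 0 k) as FY.
    rewrite alpha_0, bdist_0_r in FX by exact BX. rewrite alpha_0, bdist_0_r in FY by exact BY.
    apply Rabs_le_between in FX, FY.
    pose proof (bnorm_le_dist X BX (alpha X i) x).
    pose proof (bnorm_le_dist Y BY (T x) (alpha Y j)). rewrite (bdist_sym Y BY) in Hj.
    apply (Rmult_lt_compat_r (4 * (INR n + 1))) in Hr; [|lra].
    replace (g / (4 * (INR n + 1)) * (4 * (INR n + 1))) with g in Hr by (field; lra).
    unfold g in Hr.
    set (fx := val (fX _)) in *. set (fy := val (fY _)) in *.
    assert (fx + ((/ 2) ^ k + val r) <= bnorm X x + 4 * val r) by lra.
    apply Rle_lt_trans with (INR n * (bnorm X x + 4 * val r)); [now apply Rmult_le_compat_l|].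
    nra.
  - intros [m Hm] Hb. unfold nonbound in Hm.
    destruct (p (nfst m)) as [|b] eqn:Hp; cbn [ifz Nat.pred] in Hm; [discriminate|].
    destruct (refutes b (nfst (nsnd m)) (nsnd (nsnd m))) eqn:Hr; cbn [ifz] in Hm; [|discriminate].
    injection Hm as Hm. rewrite Hm in Hr. clear Hm.
    apply ltQ_spec in Hr. rewrite val_mulQ, val_subQ, !val_addQ, val_natQ, val_halfpowQ in Hr.
    destruct (ball_meets_graph _ _ Hp) as (x & Hx & Hy). specialize (Hb x).
    pose proof (fX_spec (nfst (nfst b)) 0 (nsnd (nsnd m))) as FX.
    pose proof (fY_spec (nsnd (nfst b)) 0 (nsnd (nsnd m))) as FY.
    rewrite alpha_0, bdist_0_r in FX by exact BX. rewrite alpha_0, bdist_0_r in FY by exact BY.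
    apply Rabs_le_between in FX, FY.
    set (fx := val (fX _)) in *. set (fy := val (fY _)) in *.
    pose proof (bnorm_le_dist X BX x (alpha X (nfst (nfst b)))).
    pose proof (bnorm_le_dist Y BY (alpha Y (nsnd (nfst b))) (T x)) as H1.
    rewrite (bdist_sym Y BY) in H1.
    assert (INR n * bnorm X x <= INR n * (fx + ((/ 2) ^ nsnd (nsnd m) + val (nsnd b)))).
    { apply Rmult_le_compat_l; lra. }
    lra.
Qed.

Lemma operator_bound_exists : exists n, operator_bound n.
Proof.
  destruct T_bounded as (_ & _ & C & HC).
  destruct (INR_unbounded C) as [n Hn]. exists n. intros x.
  eapply Rle_trans; [apply HC|]. apply Rmult_le_compat_r; [now apply bnorm_nonneg|lra].
Qed.

(** The prefix length acts as a clock: length S <t, u> starts the trial with entry t of the graph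
    name and entry u of the point, and such a prefix always contains entry u. A trial that succeeds
    is right because T is Lipschitz with constant N; a small enough ball makes one succeed. *)
Lemma evaluate_spec r : operator_bound (r 0%nat) ->
  rs_name (CFun X Y) (fun x => evaluate x (pairB p r)) T.
Proof.
  intros Hb q x Hq. set (N := r 0%nat) in *.
  pose proof (pos_INR N) as HN.
  assert (P1 : pairB p r 1%nat = N) by exact (pairB_odd p r 0%nat).
  destruct T_bounded as (Tadd & Tscal & _).
  assert (lip : forall x y, bdist Y (T x) (T y) <= INR N * bdist X x y).
  { apply bounded_operator_lipschitz; assumption. }
  destruct (assoc_eval_intro (fun x => evaluate x (pairB p r)) q) as (s & Hs & Hval).
  - intros m.
    (* The approximate distance is at most 2 * 2^-u + c, and the test adds 2 * 2^-u + c; with 2^-u <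
       c this is below 6 c. So N * 6 c + c < 2^-m is enough. *)
    destruct (val_between ((/ 2) ^ m / (6 * INR N + 1))) as (c & Hc0 & Hc).
    { apply Rdiv_lt_0_compat; [apply pow_lt|]; lra. }
    destruct (halfpow_small (val c) Hc0) as [u Hu].
    destruct (small_ball_enumerated x c Hc0) as (t & i & j & Ht & Hi & Hj).
    exists (S (npair t u)). unfold evaluate. cbv zeta.
    unpair. rewrite clen_prefix. cbn [Nat.pred ifz].
    unpair. rewrite pairB_even, Ht, P1. cbn [Nat.pred ifz].
    unpair.
    rewrite cnth_prefix by (pose proof (nsnd_le (npair t u)); rewrite nsnd_npair in *; lia).
    match goal with |- ifz ?c _ _ <> _ => assert (E : c = 0%nat) end; [|now rewrite E].
    apply ltQ_spec. rewrite !val_addQ, val_mulQ, !val_addQ, val_natQ, !val_halfpowQ.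
    pose proof (fX_spec (q u) i u) as FX. apply Rabs_le_between in FX.
    pose proof (Hq u) as Hqu.
    pose proof (bdist_triangle X BX (alpha X (q u)) x (alpha X i)) as Htr.
    rewrite (bdist_sym X BX x) in Htr.
    apply (Rmult_lt_compat_r (6 * INR N + 1)) in Hc; [|lra].
    replace ((/ 2) ^ m / (6 * INR N + 1) * (6 * INR N + 1)) with ((/ 2) ^ m) in Hc by (field; lra).
    set (fx := val (fX _)) in *.
    assert (INR N * (fx + ((/ 2) ^ u + (/ 2) ^ u + val c)) <= INR N * (6 * val c)).
    { apply Rmult_le_compat_l; lra. }
    lra.
  - exists s. split; [exact Hs|]. intros m. destruct (Hval m) as [k Hk].
    unfold evaluate in Hk. cbv zeta in Hk.
    rewrite !nfst_npair, !nsnd_npair, clen_prefix in Hk.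
    destruct k as [|k]; cbn [ifz Nat.pred] in Hk; [discriminate|].
    rewrite pairB_even, P1 in Hk.
    set (t := nfst k) in *. set (u := nsnd k) in *.
    rewrite cnth_prefix in Hk by (pose proof (nsnd_le k); unfold u; lia).
    destruct (p t) as [|b] eqn:Hp; cbn [ifz Nat.pred] in Hk; [discriminate|].
    match type of Hk with ifz ?c _ _ = _ => destruct c eqn:E end; cbn [ifz] in Hk; [|discriminate].
    injection Hk as Hk. rewrite <- Hk. clear Hk.
    apply ltQ_spec in E. rewrite !val_addQ, val_mulQ, !val_addQ, val_natQ, !val_halfpowQ in E.
    destruct (ball_meets_graph _ _ Hp) as (x' & Hx' & Hy').
    pose proof (fX_spec (q u) (nfst (nfst b)) u) as FX. apply Rabs_le_between in FX.
    pose proof (Hq u) as Hqu.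
    set (fx := val (fX _)) in *. set (a := alpha X (nfst (nfst b))) in *.
    pose proof (bdist_triangle X BX x' a x) as H1.
    pose proof (bdist_triangle X BX a (alpha X (q u)) x) as H2.
    rewrite (bdist_sym X BX a (alpha X (q u))) in H2.
    pose proof (lip x' x) as H3.
    pose proof (bdist_triangle Y BY (alpha Y (nsnd (nfst b))) (T x') (T x)) as H4.
    rewrite (bdist_sym Y BY _ (T x')) in H4.
    assert (INR N * bdist X x' x <= INR N * (fx + ((/ 2) ^ u + (/ 2) ^ u + val (nsnd b)))).
    { apply Rmult_le_compat_l; lra. }
    lra.
Qed.

End ClosedGraph.

Theorem CGT_le_C_N X Y : is_computable_banach_space X -> is_computable_banach_space Y ->
  weihrauch_le (CGT X Y) C_N.
Proof.
  intros HX HY.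
  destruct (proj2 (proj2 HX)) as (fX & fXc & fXs). destruct (proj2 (proj2 HY)) as (fY & fYc & fYs).
  (* [evaluate] reads the entries 1 and 2 t of the pair, and 2 t + 2 exceeds both. *)
  set (use := fun x => S (S (2 * nfst (Nat.pred (clen (nsnd x)))))).
  exists (fun z => ifz (use (nfst z) - clen (nsnd z))
            (S (evaluate fX (nfst z) (cnth (nsnd z)))) 0)%nat.
  exists (fun z => ifz (S (nfst (nfst z)) - clen (nsnd z))
            (S (nonbound fX fY (nfst z) (cnth (nsnd z)))) 0)%nat.
  split; [|split].
  - apply assoc_bounded_use_computable; [unfold use; auto 60 with crec|].
    now apply evaluate_computable.
  - apply (assoc_bounded_use_computable (fun m => S (nfst m)) (nonbound fX fY));
      [auto 60 with crec|].
    now apply nonbound_computable.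
  - intros G HG p A Hp [T [HT Hgraph]].
    destruct (HG (fun m => nonbound fX fY m p) (operator_bound X Y T)) as (r & HGr & n & Hrn & Hn).
    + intros n. exact (nonbound_spec X Y HX HY fX fY fXs fYs p A T Hp Hgraph n).
    + exact (operator_bound_exists X Y HX T HT).
    + exists (fun x => evaluate fX x (pairB p r)). split.
      * exists (fun m => nonbound fX fY m p), r. split; [|split; [exact HGr|]].
        -- apply (assoc_eval_bounded_use (fun m => S (nfst m)) (nonbound fX fY)).
           intros m p' E. unfold nonbound. now rewrite (E (nfst m)) by lia.
        -- apply (assoc_eval_bounded_use use (evaluate fX)).
           intros x p' E. unfold evaluate. cbv zeta. unfold use in E.
           now rewrite (E 1%nat), (E (2 * nfst (Nat.pred (clen (nsnd x))))%nat) by lia.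
      * exists T. split; [|now split].
        apply (evaluate_spec X Y HX HY fX fXs p A T Hp HT Hgraph).
        simpl in Hrn. rewrite Hrn. exact Hn.
Qed.

(** * The computable Hilbert space l2 *)

(** The upper end is excluded, so that inductions start from the empty sum, which [sum_n] cannot
    express. *)
Fixpoint fsum (f : nat -> R) (n : nat) : R :=
  match n with O => 0 | S k => fsum f k + f k end.

Lemma fsum_ext f g n : (forall i, (i < n)%nat -> f i = g i) -> fsum f n = fsum g n.
Proof.
  induction n as [|n IH]; intros H; [reflexivity|]. simpl.
  rewrite IH by (intros; apply H; lia). now rewrite H by lia.
Qed.

Lemma fsum_le f g n : (forall i, (i < n)%nat -> f i <= g i) -> fsum f n <= fsum g n.
Proof.
  induction n as [|n IH]; intros H; simpl; [lra|].
  apply Rplus_le_compat; [apply IH; intros; apply H|apply H]; lia.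
Qed.

Lemma fsum_plus f g n : fsum (fun i => f i + g i) n = fsum f n + fsum g n.
Proof. induction n as [|n IH]; simpl; [ring|rewrite IH; ring]. Qed.

Lemma fsum_scal c f n : fsum (fun i => c * f i) n = c * fsum f n.
Proof. induction n as [|n IH]; simpl; [ring|rewrite IH; ring]. Qed.

Lemma fsum_mono f m n : (forall i, 0 <= f i) -> (m <= n)%nat -> fsum f m <= fsum f n.
Proof.
  intros Hf H. induction H as [|n H IH]; simpl; [lra|]. specialize (Hf n). lra.
Qed.

Lemma fsum_stationary f m n :
  (forall i, (m <= i)%nat -> f i = 0) -> (m <= n)%nat -> fsum f n = fsum f m.
Proof.
  intros Hf H. induction H as [|n H IH]; simpl; [reflexivity|]. rewrite IH, Hf by lia. ring.
Qed.

Lemma sum_n_fsum f n : sum_n f n = fsum f (S n).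
Proof.
  induction n as [|n IH]; [rewrite sum_O; symmetry; apply Rplus_0_l|].
  rewrite sum_Sn, IH. reflexivity.
Qed.

Lemma is_lim_seq_fsum (f : nat -> R) (l : R) : is_series f l <-> is_lim_seq (fsum f) (Finite l).
Proof.
  rewrite (is_lim_seq_incr_1 (fsum f)).
  change (is_series f l) with (is_lim_seq (sum_n f) (Finite l)).
  split; apply is_lim_seq_ext; intros n; [|symmetry]; apply sum_n_fsum.
Qed.

Lemma fsum_le_Series f n : (forall i, 0 <= f i) -> ex_series f -> fsum f n <= Series f.
Proof.
  intros Hf Hex. apply Series_correct, is_lim_seq_fsum in Hex.
  apply (is_lim_seq_incr_compare (fsum f)); [exact Hex|].
  intros k. simpl. specialize (Hf k). lra.
Qed.

Lemma Series_le_bound f B : ex_series f -> (forall n, fsum f n <= B) -> Series f <= B.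
Proof.
  intros Hex H. apply Series_correct, is_lim_seq_fsum in Hex.
  apply (is_lim_seq_le (fsum f) (fun _ => B) (Series f) B); [exact H|exact Hex|].
  apply is_lim_seq_const.
Qed.

Lemma ex_series_bounded f B : (forall i, 0 <= f i) -> (forall n, fsum f n <= B) -> ex_series f.
Proof.
  intros Hf H. destruct (ex_finite_lim_seq_incr (fsum f) B) as [l Hl].
  - intros n. simpl. specialize (Hf n). lra.
  - exact H.
  - exists l. now apply is_lim_seq_fsum.
Qed.

Lemma is_series_finite f n : (forall i, (n <= i)%nat -> f i = 0) -> is_series f (fsum f n).
Proof.
  intros H. apply is_lim_seq_fsum. apply is_lim_seq_ext_loc with (fun _ => fsum f n).
  - exists n. intros m Hm. symmetry. now apply fsum_stationary.
  - apply is_lim_seq_const.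
Qed.

Notation coord x i := (proj1_sig (x : l2car) i).

Lemma l2_ext (x y : bcar l2) : (forall i, coord x i = coord y i) -> x = y.
Proof.
  destruct x as [x Hx], y as [y Hy]; simpl; intros H.
  assert (x = y) by now apply functional_extensionality. subst y. f_equal. apply proof_irrelevance.
Qed.

Definition l2_sq (x : bcar l2) : R := Series (fun n => coord x n ^ 2).

Lemma l2_sq_nonneg x : 0 <= l2_sq x.
Proof. apply (fsum_le_Series _ 0 (fun i => pow2_ge_0 _) (proj2_sig x)). Qed.

Lemma l2_norm_sqrt x : bnorm l2 x = sqrt (l2_sq x).
Proof. reflexivity. Qed.

Lemma l2_norm_nonneg x : 0 <= bnorm l2 x.
Proof. apply sqrt_pos. Qed.

Lemma l2_norm_sqr x : bnorm l2 x ^ 2 = l2_sq x.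
Proof. rewrite l2_norm_sqrt. apply pow2_sqrt, l2_sq_nonneg. Qed.

Lemma fsum_le_l2_norm x n : fsum (fun i => coord x i ^ 2) n <= bnorm l2 x ^ 2.
Proof. rewrite l2_norm_sqr. apply fsum_le_Series; [intros; apply pow2_ge_0|exact (proj2_sig x)]. Qed.

Lemma l2_norm_le x B : 0 <= B -> (forall n, fsum (fun i => coord x i ^ 2) n <= B ^ 2) ->
  bnorm l2 x <= B.
Proof.
  intros HB H. apply Rsqr_incr_0_var; [|exact HB].
  rewrite !Rsqr_pow2, l2_norm_sqr. apply Series_le_bound; [exact (proj2_sig x)|exact H].
Qed.

Lemma l2_norm_finite x n : (forall i, (n <= i)%nat -> coord x i = 0) ->
  bnorm l2 x ^ 2 = fsum (fun i => coord x i ^ 2) n.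
Proof.
  intros H. rewrite l2_norm_sqr. apply is_series_unique. apply (is_series_finite (fun i => coord x i ^ 2)).
  intros i Hi. rewrite H by exact Hi. ring.
Qed.

Lemma coord_le_l2_norm x i : Rabs (coord x i) <= bnorm l2 x.
Proof.
  apply Rsqr_incr_0_var; [|apply l2_norm_nonneg]. rewrite <- Rsqr_abs, !Rsqr_pow2.
  eapply Rle_trans; [|apply (fsum_le_l2_norm x (S i))]. cbn [fsum].
  pose proof (fsum_mono (fun i => coord x i ^ 2) 0 i (fun i => pow2_ge_0 _) (Nat.le_0_l i)) as H.
  cbn [fsum] in H. lra.
Qed.

(* For s, t > 0 with s + t = 1, convexity of the square gives
   (x + y)^2 <= x^2 / s + y^2 / t; the choice s : t = |x| : |y| yields Minkowski. *)
Lemma l2_norm_triangle x y : bnorm l2 (badd l2 x y) <= bnorm l2 x + bnorm l2 y.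
Proof.
  pose proof (l2_norm_nonneg x) as Ha. pose proof (l2_norm_nonneg y) as Hb.
  set (a := bnorm l2 x) in *. set (b := bnorm l2 y) in *.
  apply l2_norm_le; [lra|]. intros n.
  change (fsum (fun i => (coord x i + coord y i) ^ 2) n <= (a + b) ^ 2).
  pose proof (fsum_le_l2_norm x n) as Hx. pose proof (fsum_le_l2_norm y n) as Hy.
  fold a in Hx. fold b in Hy.
  destruct (Req_dec a 0) as [A0|A0]; [|destruct (Req_dec b 0) as [B0|B0]].
  - rewrite (fsum_ext _ (fun i => coord y i ^ 2)); [nra|].
    intros i _. pose proof (coord_le_l2_norm x i) as H. fold a in H. rewrite A0 in H.
    pose proof (Rabs_pos (coord x i)). assert (E : Rabs (coord x i) = 0) by lra.
    apply Rabs_eq_0 in E. rewrite E. ring.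
  - rewrite (fsum_ext _ (fun i => coord x i ^ 2)); [nra|].
    intros i _. pose proof (coord_le_l2_norm y i) as H. fold b in H. rewrite B0 in H.
    pose proof (Rabs_pos (coord y i)). assert (E : Rabs (coord y i) = 0) by lra.
    apply Rabs_eq_0 in E. rewrite E. ring.
  (* Multiplied by a b to avoid division: termwise the two sides then differ by (b x_i - a
     y_i)^2. *)
  - assert (a * b * fsum (fun i => (coord x i + coord y i) ^ 2) n <= a * b * (a + b) ^ 2).
    { rewrite <- fsum_scal.
      apply Rle_trans with
        (fsum (fun i => (a + b) * b * coord x i ^ 2 + (a + b) * a * coord y i ^ 2) n).
      - apply fsum_le. intros i _. pose proof (pow2_ge_0 (b * coord x i - a * coord y i)). nra.
      - rewrite fsum_plus, !fsum_scal.
        assert ((a + b) * b * fsum (fun i => coord x i ^ 2) n <= (a + b) * b * a ^ 2)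
          by (apply Rmult_le_compat_l; nra).
        assert ((a + b) * a * fsum (fun i => coord y i ^ 2) n <= (a + b) * a * b ^ 2)
          by (apply Rmult_le_compat_l; nra).
        lra. }
    apply Rmult_le_reg_l with (a * b); [nra|assumption].
Qed.

Lemma bdist_l2_coord (x y : bcar l2) i : Rabs (coord x i - coord y i) <= bdist l2 x y.
Proof.
  eapply Rle_trans; [|apply (coord_le_l2_norm _ i)]. right. simpl. f_equal. ring.
Qed.

Lemma l2_complete (u : nat -> bcar l2) :
  (forall eps, 0 < eps -> exists N, forall m n, (N <= m)%nat -> (N <= n)%nat ->
     bdist l2 (u m) (u n) < eps) ->
  exists x, forall eps, 0 < eps -> exists N, forall n, (N <= n)%nat -> bdist l2 (u n) x < eps.
Proof.
  intros Hu.
  assert (Hlim : forall i, is_lim_seq (fun n => coord (u n) i) (real (Lim_seq (fun n => coord (u n) i)))).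
  { intros i. apply Lim_seq_correct', ex_lim_seq_cauchy_corr. intros eps.
    destruct (Hu eps (cond_pos eps)) as [N HN]. exists N. intros n m Hn Hm.
    eapply Rle_lt_trans; [apply bdist_l2_coord|now apply HN]. }
  set (lim := fun i => real (Lim_seq (fun n => coord (u n) i))) in *.
  (* The Cauchy estimate passes to the coordinatewise limit on each finite partial sum, with a bound
     independent of [K]. *)
  assert (Hclose : forall eps, 0 < eps -> exists N, forall n, (N <= n)%nat ->
            forall K, fsum (fun i => (coord (u n) i - lim i) ^ 2) K <= eps ^ 2).
  { intros eps He. destruct (Hu eps He) as [N HN]. exists N. intros n Hn K.
    assert (L : is_lim_seq (fun m => fsum (fun i => (coord (u n) i - coord (u m) i) ^ 2) K)
                  (fsum (fun i => (coord (u n) i - lim i) ^ 2) K)).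
    { induction K as [|K IH]; cbn [fsum]; [apply is_lim_seq_const|].
      apply is_lim_seq_plus'; [exact IH|].
      apply is_lim_seq_ext with
        (fun m => (coord (u n) K - coord (u m) K) * (coord (u n) K - coord (u m) K)).
      { intros; ring. }
      replace ((coord (u n) K - lim K) ^ 2) with
        ((coord (u n) K - lim K) * (coord (u n) K - lim K)) by ring.
      apply is_lim_seq_mult';
        (apply is_lim_seq_minus'; [apply is_lim_seq_const | apply Hlim]). }
    apply (is_lim_seq_le_loc _ (fun _ => eps ^ 2) _ (eps ^ 2)) in L;
      [exact L| |apply is_lim_seq_const].
    exists N. intros m Hm. specialize (HN n m Hn Hm).
    pose proof (fsum_le_l2_norm (badd l2 (u n) (bscal l2 (-1) (u m))) K) as H.
    pose proof (l2_norm_nonneg (badd l2 (u n) (bscal l2 (-1) (u m)))).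
    unfold bdist in HN.
    apply Rle_trans with (bnorm l2 (badd l2 (u n) (bscal l2 (-1) (u m))) ^ 2); [|nra].
    eapply Rle_trans; [|exact H]. right. apply fsum_ext. intros i _. simpl. ring. }
  destruct (Hclose 1) as [N HN]; [lra|].
  (* Square summability of [lim] itself is not shown directly: the limit is built as [u N] minus
     this square summable difference. *)
  assert (Hd : ex_series (fun i => (coord (u N) i - lim i) ^ 2)).
  { apply ex_series_bounded with (1 ^ 2); [intros; apply pow2_ge_0|apply HN, le_n]. }
  set (d := exist (fun x => ex_series (fun n => x n ^ 2)) (fun i => coord (u N) i - lim i) Hd : l2car).
  exists (badd l2 (u N) (bscal l2 (-1) d)). intros eps He.
  destruct (Hclose (eps / 2)) as [M HM]; [lra|]. exists M. intros n Hn.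
  apply Rle_lt_trans with (eps / 2); [|lra]. apply l2_norm_le; [lra|]. intros K.
  eapply Rle_trans; [|apply (HM n Hn K)]. right. apply fsum_ext. intros i _. simpl. ring.
Qed.

Lemma l2_banach : is_banach_space l2.
Proof.
  unfold is_banach_space. repeat match goal with |- _ /\ _ => split end.
  - intros; apply l2_ext; intros; simpl; ring.
  - intros; apply l2_ext; intros; simpl; ring.
  - intros; apply l2_ext; intros; simpl; ring.
  - intros; apply l2_ext; intros; simpl; ring.
  - intros; apply l2_ext; intros; simpl; ring.
  - intros; apply l2_ext; intros; simpl; ring.
  - intros; apply l2_ext; intros; simpl; ring.
  - intros; apply l2_ext; intros; simpl; ring.
  - intros x Hx. apply l2_ext. intros i. pose proof (coord_le_l2_norm x i) as H.
    rewrite Hx in H. pose proof (Rabs_pos (coord x i)).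
    apply Rabs_eq_0. lra.
  - intros a x. rewrite !l2_norm_sqrt, <- sqrt_Rsqr_abs, <- sqrt_mult_alt by apply Rle_0_sqr.
    f_equal. unfold l2_sq. rewrite <- Series_scal_l. apply Series_ext. intros n.
    simpl. unfold Rsqr. ring.
  - apply l2_norm_triangle.
  - exact l2_complete.
Qed.

Lemma coord_comb_from l : forall k i,
  coord (comb_from l2 k l) i = if Nat.ltb i k then 0 else nth (i - k) l 0.
Proof.
  induction l as [|c l IH]; intros k i.
  - simpl. destruct (Nat.ltb i k); [reflexivity|]. now destruct (i - k)%nat.
  - cbn [comb_from]. simpl. rewrite IH.
    destruct (Nat.eqb_spec i k) as [->|E].
    + rewrite Nat.ltb_irrefl, Nat.sub_diag.
      destruct (Nat.ltb_spec k (S k)); [ring|lia].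
    + destruct (Nat.ltb_spec i k), (Nat.ltb_spec i (S k)); try lia; [ring|].
      replace (i - k)%nat with (S (i - S k)) by lia. ring.
Qed.

Lemma coord_alpha n i : coord (alpha l2 n) i = val (cnth n i).
Proof.
  unfold alpha. rewrite coord_comb_from. simpl. rewrite Nat.sub_0_r, cnth_nth.
  rewrite <- val_0 at 1. apply (map_nth val).
Qed.

Lemma l2_finite_dense (x : bcar l2) eps : 0 < eps -> exists l, bdist l2 (comb_from l2 0 l) x < eps.
Proof.
  intros He. pose proof (Series_correct _ (proj2_sig x)) as HS. apply is_lim_seq_fsum in HS.
  apply is_lim_seq_spec in HS. assert (He2 : 0 < (eps / 2) ^ 2) by (apply pow_lt; lra).
  destruct (HS (mkposreal _ He2)) as [N HN]. cbn [pos] in HN.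
  exists (map (fun i => coord x i) (seq 0 N)).
  apply Rle_lt_trans with (eps / 2); [|lra]. apply l2_norm_le; [lra|]. intros K.
  apply Rle_trans with (fsum (fun i => coord x i ^ 2) (N + K) - fsum (fun i => coord x i ^ 2) N).
  (* Enlarging [K] to [N + K] lets the induction start at the point of truncation. *)
  - eapply Rle_trans; [apply (fsum_mono _ K (N + K) (fun i => pow2_ge_0 _)); lia|].
    assert (E : forall i, coord (badd l2 (comb_from l2 0 (map (fun i => coord x i) (seq 0 N)))
              (bscal l2 (-1) x)) i = if Nat.ltb i N then 0 else - coord x i).
    { intros i. cbn [badd bscal l2 proj1_sig]. rewrite coord_comb_from. simpl Nat.ltb.
      rewrite Nat.sub_0_r. destruct (Nat.ltb_spec i N).
      - rewrite nth_indep with (d' := coord x 0%nat) by (rewrite length_map, length_seq; lia).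
        rewrite (map_nth (fun i => coord x i)), seq_nth by lia. simpl. ring.
      - rewrite nth_overflow by (rewrite length_map, length_seq; lia). cbn. ring. }
    induction K as [|K IH].
    + rewrite Nat.add_0_r. rewrite (fsum_ext _ (fun _ => 0 * 0)).
      * rewrite fsum_scal. lra.
      * intros i Hi. rewrite E. destruct (Nat.ltb_spec i N); [ring|lia].
    + rewrite Nat.add_succ_r. cbn [fsum]. rewrite E.
      destruct (Nat.ltb_spec (N + K) N); [lia|]. simpl in IH |- *. lra.
  - specialize (HN N (le_n N)). apply Rabs_def2 in HN.
    pose proof (fsum_le_Series _ (N + K) (fun i => pow2_ge_0 (coord x i)) (proj2_sig x)).
    simpl in *. lra.
Qed.

(** * Computability of the metric of l2 *)

Definition sumQ (F : nat -> nat) (n : nat) : nat := prec 0 (fun i r => addQ r (F i)) n.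

Lemma val_sumQ F n : val (sumQ F n) = fsum (fun i => val (F i)) n.
Proof.
  induction n as [|n IH]; [apply val_0|].
  change (sumQ F (S n)) with (addQ (sumQ F n) (F n)). rewrite val_addQ, IH. reflexivity.
Qed.

Lemma sumQ_ext F F' n : (forall i, (i < n)%nat -> F i = F' i) -> sumQ F n = sumQ F' n.
Proof.
  induction n as [|n IH]; intros H; [reflexivity|]. unfold sumQ in *. cbn [prec].
  rewrite IH by (intros; apply H; lia). now rewrite H by lia.
Qed.

Definition sqrQ (x : nat) : nat := mulQ x x.

Lemma val_sqrQ x : val (sqrQ x) = val x ^ 2.
Proof. unfold sqrQ. rewrite val_mulQ. ring. Qed.

(** Squared distances of rational vectors are rational, hence exact, and serve in all strict
    comparisons. Any [n] not below the two codes gives enough terms. *)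
Definition sqdistQ (x y n : nat) : nat := sumQ (fun i => sqrQ (subQ (cnth x i) (cnth y i))) n.

Lemma val_sqdistQ x y n : (x <= n)%nat -> (y <= n)%nat ->
  val (sqdistQ x y n) = bdist l2 (alpha l2 x) (alpha l2 y) ^ 2.
Proof.
  intros Hx Hy. unfold sqdistQ. rewrite val_sumQ. unfold bdist.
  assert (E : forall i, coord (badd l2 (alpha l2 x) (bscal l2 (-1) (alpha l2 y))) i
                        = val (cnth x i) - val (cnth y i)).
  { intros i. cbn [badd bscal l2 proj1_sig]. rewrite !coord_alpha. ring. }
  rewrite (l2_norm_finite _ n).
  - apply fsum_ext. intros i _. now rewrite val_sqrQ, val_subQ, E.
  - intros i Hi. rewrite E, !cnth_overflow, val_0 by lia. ring.
Qed.

Lemma computable_sqdistQ a b n :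
  computable_nat a -> computable_nat b -> computable_nat n ->
  computable_nat (fun x => sqdistQ (a x) (b x) (n x)).
Proof. intros. unfold sqdistQ, sumQ, sqrQ. auto 60 with crec. Qed.
#[local] Hint Resolve computable_sqdistQ : crec.

(** [c] is the integer part of s 2^k; it is characterised through squares, since in the application
    only s^2 is known to be rational. *)
Lemma rational_sqrt_approx s k c : 0 <= s ->
  s ^ 2 * (2 ^ k) ^ 2 < (INR c + 1) ^ 2 ->
  (forall m, (m < c)%nat -> (INR m + 1) ^ 2 <= s ^ 2 * (2 ^ k) ^ 2) ->
  Rabs (s - INR c / 2 ^ k) <= (/ 2) ^ k.
Proof.
  intros Hs Hc Hm. assert (Hp : 0 < 2 ^ k) by (apply pow_lt; lra).
  rewrite pow_inv. pose proof (pos_INR c) as Hc0.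
  rewrite <- Rpow_mult_distr in Hc. assert (H0 : 0 <= s * 2 ^ k) by nra.
  assert (U : s * 2 ^ k < INR c + 1) by nra.
  assert (L : INR c <= s * 2 ^ k).
  { destruct c as [|c]; [exact H0|]. specialize (Hm c (Nat.lt_succ_diag_r c)).
    rewrite <- Rpow_mult_distr in Hm. rewrite S_INR in *. pose proof (pos_INR c).
    clear Hc U. set (t := s * 2 ^ k) in *. nra. }
  apply Rmult_le_reg_r with (2 ^ k); [exact Hp|].
  rewrite Rinv_l by lra. rewrite <- (Rabs_pos_eq (2 ^ k)) at 2 by lra.
  rewrite <- Rabs_mult.
  replace ((s - INR c / 2 ^ k) * 2 ^ k) with (s * 2 ^ k - INR c) by (field; lra).
  rewrite Rabs_pos_eq; lra.
Qed.

Lemma l2_computable_banach : is_computable_banach_space l2.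
Proof.
  split; [exact l2_banach|]. split; [exact l2_finite_dense|].
  set (test := fun z m => ltQ
    (mulQ (sqdistQ (nfst (nfst z)) (nsnd (nfst z)) (nfst (nfst z) + nsnd (nfst z)))
          (natQ (npow 2 (nsnd z) * npow 2 (nsnd z))))
    (natQ (S m * S m))).
  assert (Htest : forall i j k m, test (npair (npair i j) k) m = 0%nat <->
     bdist l2 (alpha l2 i) (alpha l2 j) ^ 2 * (2 ^ k) ^ 2 < (INR m + 1) ^ 2).
  { intros i j k m. unfold test. unpair.
    rewrite ltQ_spec, val_mulQ, val_sqdistQ, !val_natQ, !mult_INR, npow_INR, (S_INR m) by lia.
    change (INR 2) with 2. replace ((2 ^ k) ^ 2) with (2 ^ k * 2 ^ k) by ring.
    replace ((INR m + 1) ^ 2) with ((INR m + 1) * (INR m + 1)) by ring. reflexivity. }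
  destruct (computable_min test) as (f & Hf & Hspec).
  - apply computable2_unpair. unfold test. auto 60 with crec.
  - intros z. rewrite <- (npair_surj z), <- (npair_surj (nfst z)).
    set (D := bdist l2 (alpha l2 (nfst (nfst z))) (alpha l2 (nsnd (nfst z)))).
    destruct (INR_unbounded (D * 2 ^ nsnd z)) as [m Hm]. exists m. apply Htest. fold D.
    assert (0 <= D) by apply l2_norm_nonneg.
    assert (0 < 2 ^ nsnd z) by (apply pow_lt; lra). pose proof (pos_INR m).
    assert (0 <= D * 2 ^ nsnd z) by nra. nra.
  - exists (fun z => mkQ (f z) 0 (npow 2 (nsnd z))). split; [auto 60 with crec|].
    intros i j k. fold (val (mkQ (f (npair (npair i j) k)) 0 (npow 2 (nsnd (npair (npair i j) k))))).
    rewrite val_mkQ by (apply npow_pos; lia). unpair. rewrite npow_INR.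
    change (INR 2) with 2. change (INR 0) with 0. rewrite Rminus_0_r.
    destruct (Hspec (npair (npair i j) k)) as [H0 Hm]. rewrite Htest in H0.
    apply rational_sqrt_approx; [apply l2_norm_nonneg|exact H0|].
    intros m Hlt. apply Rnot_lt_le. rewrite <- Htest. now apply Hm.
Qed.

(** * Finding an element of a co-enumerated set from an operator *)

Definition absdiff (a b : nat) : nat := ((a - b) + (b - a))%nat.

Lemma absdiff_eq_0 a b : absdiff a b = 0%nat <-> a = b.
Proof. unfold absdiff. lia. Qed.

(* Every index is [nfst k] for arbitrarily large k, so a wrong guess is refuted eventually. *)
Definition guess (p : Baire) (t : nat) : nat :=
  prec 0 (fun k r => ifz (absdiff (p (nfst k)) (S r)) (S r) r) t.

Lemma guess_S p t :
  guess p (S t) = ifz (absdiff (p (nfst t)) (S (guess p t))) (S (guess p t)) (guess p t).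
Proof. reflexivity. Qed.

Lemma guess_ext p p' m t : (forall i, (i < m)%nat -> p i = p' i) -> (t <= m)%nat ->
  guess p t = guess p' t.
Proof.
  intros H. induction t as [|t IH]; intros Ht; [reflexivity|].
  rewrite !guess_S, IH by lia. rewrite H; [reflexivity|]. pose proof (nfst_le t). lia.
Qed.

Lemma bounded_nondecreasing_stationary (f : nat -> nat) B :
  (forall t, f t <= f (S t))%nat -> (forall t, f t <= B)%nat ->
  exists M, forall t, (M <= t)%nat -> f t = f M.
Proof.
  intros Hmono HB.
  assert (Hle : forall s t, (s <= t)%nat -> (f s <= f t)%nat).
  { intros s t H. induction H; [lia|]. specialize (Hmono m). lia. }
  (* Induction on the room left below [B]: each change of [f] uses up at least one unit. Whether a
     change is still to come is decided classically. *)
  assert (H : forall d M, (B - f M <= d)%nat -> exists M, forall t, (M <= t)%nat -> f t = f M).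
  { induction d as [|d IH]; intros M Hd.
    - exists M. intros t Ht. specialize (Hle M t Ht). specialize (HB t). lia.
    - destruct (classic (forall t, (M <= t)%nat -> f t = f M)) as [S|S]; [now exists M|].
      apply not_all_ex_not in S. destruct S as [t S]. apply imply_to_and in S.
      destruct S as [Ht S]. specialize (Hle M t Ht). apply (IH t). lia. }
  exact (H _ 0%nat (le_n _)).
Qed.

Lemma guess_limit p A : rs_name AMinusN p A -> (exists n, A n) ->
  exists M, (forall t, (M <= t)%nat -> guess p t = guess p M) /\ A (guess p M).
Proof.
  simpl. intros Hp [n Hn].
  (* The guess only leaves numbers that were excluded, so it cannot pass the member [n]. *)
  destruct (bounded_nondecreasing_stationary (guess p) n) as [M HM].
  - intros t. rewrite guess_S. destruct (absdiff _ _); simpl; lia.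
  - induction t as [|t IH]; [simpl; lia|]. rewrite guess_S.
    destruct (absdiff _ _) eqn:E; simpl; [|exact IH]. apply (proj1 (absdiff_eq_0 _ _)) in E.
    destruct (Nat.eq_dec (guess p t) n) as [En|En]; [|lia].
    exfalso. apply (proj2 (Hp n)); [|exact Hn]. exists (nfst t). now rewrite E, En.
  - exists M. split; [exact HM|]. apply NNPP. intros H. apply Hp in H. destruct H as [k Hk].
    (* Stage [npair k M] inspects entry [k] once more after [M], and would move the guess. *)
    assert (HMt : (M <= npair k M)%nat) by (rewrite npair_tri; lia).
    pose proof (guess_S p (npair k M)) as E. rewrite nfst_npair in E.
    rewrite (HM (npair k M)), (HM (S (npair k M))), Hk in E by lia.
    rewrite (proj2 (absdiff_eq_0 (S (guess p M)) _) eq_refl) in E. cbn [ifz] in E. lia.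
Qed.

(* The functional with e_0 |-> lim g and e_(k+1) |-> 2^k (g k - g (k+1)), cut off after L
   terms. By telescoping it sends e_0 + sum_(k >= m) 2^-k e_(k+1) to g m, which is known at
   stage m: the value at e_0 may still be corrected within an error 2^-m of the argument. *)
Definition phi (g : nat -> nat) (L : nat) (x : nat -> R) : R :=
  INR (g L) * x 0%nat
  + fsum (fun k => 2 ^ k * (INR (g k) - INR (g (S k))) * x (S k)) L.

(** The correction vanishes for two reasons: either g no longer changes, or x_(L+1) = 2^-L x_0. The
    next two lemmas exploit one each. *)
Lemma phi_S g L x : phi g (S L) x =
  phi g L x + (INR (g L) - INR (g (S L))) * (2 ^ L * x (S L) - x 0%nat).
Proof. unfold phi. cbn [fsum]. ring. Qed.

Lemma phi_stationary g M L x : (forall t, (M <= t)%nat -> g t = g M) -> (M <= L)%nat ->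
  phi g L x = phi g M x.
Proof.
  intros Hg H. induction H as [|L H IH]; [reflexivity|].
  rewrite phi_S, IH, (Hg L), (Hg (S L)) by lia. ring.
Qed.

Lemma phi_telescope g m L x : (m <= L)%nat ->
  (forall k, (m <= k < L)%nat -> x (S k) = x 0%nat * (/ 2) ^ k) -> phi g L x = phi g m x.
Proof.
  intros H. induction H as [|L H IH]; intros Hx; [reflexivity|].
  rewrite phi_S, IH by (intros; apply Hx; lia). rewrite Hx by lia.
  rewrite pow_inv. assert (2 ^ L <> 0) by (apply pow_nonzero; lra). field_simplify; [|assumption].
  ring.
Qed.

Lemma phi_ext g L x y : (forall i, (i <= L)%nat -> x i = y i) -> phi g L x = phi g L y.
Proof.
  intros H. unfold phi. rewrite H by lia. f_equal. apply fsum_ext.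
  intros i Hi. now rewrite H by lia.
Qed.

Lemma phi_linear g L a x y : phi g L (fun i => a * x i + y i) = a * phi g L x + phi g L y.
Proof.
  unfold phi. rewrite (fsum_ext _ (fun k =>
    a * (2 ^ k * (INR (g k) - INR (g (S k))) * x (S k))
    + 2 ^ k * (INR (g k) - INR (g (S k))) * y (S k))) by (intros; ring).
  rewrite fsum_plus, fsum_scal. ring.
Qed.

Lemma phi_bounded g L : exists C, forall x : bcar l2,
  Rabs (phi g L (fun i => coord x i)) <= C * bnorm l2 x.
Proof.
  exists (INR (g L) + fsum (fun k => Rabs (2 ^ k * (INR (g k) - INR (g (S k))))) L). intros x.
  unfold phi. eapply Rle_trans; [apply Rabs_triang|]. rewrite Rmult_plus_distr_r.
  apply Rplus_le_compat.
  - rewrite Rabs_mult, (Rabs_pos_eq (INR _)) by apply pos_INR.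
    apply Rmult_le_compat_l; [apply pos_INR|apply coord_le_l2_norm].
  - generalize L at 1 2. intros n. induction n as [|n IH]; cbn [fsum]; [rewrite Rabs_R0; lra|].
    eapply Rle_trans; [apply Rabs_triang|]. rewrite Rmult_plus_distr_r.
    apply Rplus_le_compat; [exact IH|]. rewrite Rabs_mult.
    apply Rmult_le_compat_l; [apply Rabs_pos|apply coord_le_l2_norm].
Qed.

(** * The operator and the positive information on its graph *)

Definition e0_code : nat := enc_list [natQ 1].
(** This is [enc_list [c]] unfolded to a form that proof search can handle; [e0_code] is convertible
    to the case c = [natQ 1]. *)
Definition line_code (c : nat) : nat := S (npair c 0).

Lemma coord_line c i : coord (alpha l2 (line_code c)) i = if Nat.eqb i 0 then val c else 0.
Proof.
  rewrite coord_alpha, cnth_nth. unfold line_code. rewrite dec_list_S. unpair.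
  destruct i as [|[|i]]; [reflexivity|apply val_0|apply val_0].
Qed.

Definition rank1 (g : nat -> nat) (L : nat) (x : bcar l2) : bcar l2 :=
  bscal l2 (phi g L (fun i => coord x i)) (alpha l2 e0_code).

Lemma coord_rank1 g L x i :
  coord (rank1 g L x) i = if Nat.eqb i 0 then phi g L (fun i => coord x i) else 0.
Proof.
  unfold rank1. cbn [bscal l2 proj1_sig]. rewrite (coord_line (natQ 1)), val_natQ.
  destruct (Nat.eqb i 0); simpl; ring.
Qed.

Lemma rank1_linear_bounded g L : linear_bounded l2 (rank1 g L).
Proof.
  split; [|split].
  - intros x y. apply l2_ext. intros i. cbn [badd l2 proj1_sig]. rewrite !coord_rank1.
    destruct (Nat.eqb i 0); [|ring].
    transitivity (phi g L (fun i => 1 * coord x i + coord y i)).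
    + apply phi_ext. intros; simpl; ring.
    + rewrite (phi_linear g L 1 (fun i => coord x i) (fun i => coord y i)). ring.
  - intros a x. apply l2_ext. intros i. cbn [bscal l2 proj1_sig].
    change (coord (rank1 g L (bscal l2 a x)) i = a * coord (rank1 g L x) i).
    rewrite !coord_rank1.
    destruct (Nat.eqb i 0); [|ring].
    transitivity (phi g L (fun i => a * coord x i + 0 * coord x i)).
    + apply phi_ext. intros; simpl; ring.
    + rewrite (phi_linear g L a (fun i => coord x i) (fun i => 0 * coord x i)).
      (* With a = -1 linearity yields phi(0) = -phi(0) + phi(0), that is, phi(0) = 0. *)
      pose proof (phi_linear g L (-1) (fun i => 0 * coord x i) (fun i => 0 * coord x i)) as E.
      rewrite (phi_ext g L _ (fun i => 0 * coord x i)) in E by (intros; ring). lra.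
  - destruct (phi_bounded g L) as [C HC].
    exists (C * bnorm l2 (alpha l2 e0_code)). intros x. unfold rank1.
    rewrite (bnorm_scal l2 l2_banach). specialize (HC x).
    pose proof (l2_norm_nonneg (alpha l2 e0_code)). nra.
Qed.

Definition phiQ (P : Baire) (m xs : nat) : nat :=
  addQ (mulQ (natQ (guess P m)) (cnth xs 0))
    (sumQ (fun k => mulQ (mkQ (npow 2 k * guess P k) (npow 2 k * guess P (S k)) 1)
                         (cnth xs (S k))) m).

Lemma val_phiQ P m xs : val (phiQ P m xs) = phi (guess P) m (fun i => coord (alpha l2 xs) i).
Proof.
  unfold phiQ, phi. rewrite val_addQ, val_mulQ, val_natQ, val_sumQ, coord_alpha. f_equal.
  apply fsum_ext. intros k _. rewrite val_mulQ, val_mkQ, coord_alpha, !mult_INR, npow_INR by lia.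
  change (INR 2) with 2. change (INR 1) with 1. field.
Qed.

(** The full tail has squared norm x_0^2 times the sum of 4^-k over k >= m, which is 4/3 (x_0
    2^-m)^2; the factor 2 is a convenient upper bound. *)
Definition tailQ (m xs : nat) : nat := mulQ (natQ 2) (sqrQ (mulQ (cnth xs 0) (halfpowQ m))).

(* [m] codes a ball, a finite vector [xs] and a padding that makes [m] arbitrarily large.
   The candidate point is xs + xs_0 sum_(k >= m) 2^-k e_(k+1), the tail of which has squared
   norm at most [tailQ m xs]. *)
Definition graph_ball (m : nat) (P : Baire) : nat :=
  let n := nfst m in
  let xs := nfst (nsnd m) in
  let y := line_code (phiQ P m xs) in
  let a := nfst (nfst n) in
  let b := nsnd (nfst n) in
  ifz (ltQ 0 (nsnd n)
       + (ltQ (addQ (sqdistQ xs a (S m)) (tailQ m xs)) (sqrQ (nsnd n))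
       + ltQ (sqdistQ y b (y + b)) (sqrQ (nsnd n))))%nat
    (S n) 0.

Lemma computable_guess (p : nat -> nat -> nat) t :
  computable_nat (fun z => p (nsnd z) (nfst z)) ->
  computable_nat t -> computable_nat (fun x => guess (p x) (t x)).
Proof.
  intros Hp Ht. unfold guess, absdiff.
  assert (H : computable_nat (fun z => p (nsnd (nsnd z)) (nfst (nfst z)))).
  { eapply computable_ext; [|apply (computable_comp1 _ (fun z => npair (nfst (nfst z)) (nsnd (nsnd z))) Hp)].
    - intros z. cbv beta. now unpair.
    - auto 60 with crec. }
  apply computable_prec; auto 60 with crec.
Qed.

Lemma graph_ball_computable : computable_nat (fun z => graph_ball (nfst z) (cnth (nsnd z))).
Proof.
  unfold graph_ball, phiQ, tailQ, line_code, sqrQ. cbv zeta.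
  assert (H : forall a b, computable_nat a -> computable_nat b ->
    computable_nat (fun z => guess (cnth (a z)) (b z))).
  { intros a b Ha Hb. apply (computable_guess (fun z => cnth (a z)) b); [|exact Hb].
    auto 60 with crec. }
  unfold sumQ. auto 60 with crec.
Qed.

Lemma graph_ball_use m p p' : (forall i, (i < m)%nat -> p i = p' i) ->
  graph_ball m p = graph_ball m p'.
Proof.
  intros H. unfold graph_ball. cbv zeta.
  replace (phiQ p' m (nfst (nsnd m))) with (phiQ p m (nfst (nsnd m))); [reflexivity|].
  unfold phiQ. rewrite (guess_ext p p' m m H) by lia. f_equal.
  apply sumQ_ext. intros k Hk.
  now rewrite (guess_ext p p' m k H), (guess_ext p p' m (S k) H) by lia.
Qed.

Lemma finite_support_l2 (x : nat -> R) n : (forall i, (n <= i)%nat -> x i = 0) ->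
  ex_series (fun i => x i ^ 2).
Proof.
  intros H. eexists. apply (is_series_finite (fun i => x i ^ 2) n).
  intros i Hi. rewrite H by exact Hi. ring.
Qed.

Lemma val_tailQ m xs : val (tailQ m xs) = 2 * (val (cnth xs 0) * (/ 2) ^ m) ^ 2.
Proof.
  unfold tailQ. rewrite val_mulQ, val_sqrQ, val_mulQ, val_natQ, val_halfpowQ.
  change (INR 2) with 2. reflexivity.
Qed.

Lemma sqr_lt_reg x y : 0 < y -> x ^ 2 < y ^ 2 -> x < y.
Proof. intros. nra. Qed.

Lemma rank1_line g L (x : bcar l2) c : phi g L (fun i => coord x i) = val c ->
  rank1 g L x = alpha l2 (line_code c).
Proof.
  intros E. apply l2_ext. intros i. rewrite coord_rank1, coord_line, E. reflexivity.
Qed.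

Section GraphBall.
Variables (P : Baire) (M : nat).
Hypothesis P_stationary : forall t, (M <= t)%nat -> guess P t = guess P M.

(** The tail of the candidate point may be cut at coordinate m + M, because later coordinates no
    longer contribute to T x. This gives a witness of finite support on which T telescopes to the
    value computed at stage m. *)
Lemma graph_ball_sound m n : graph_ball m P = S n ->
  exists x, prod_dist l2 l2 (x, rank1 (guess P) M x) (ball_center l2 l2 n) < ball_radius n.
Proof.
  unfold graph_ball. cbv zeta. intros H.
  destruct (ltQ 0 (nsnd (nfst m))) eqn:Hr; [|discriminate].
  match type of H with context [ltQ (addQ ?u ?v) ?w] =>
    destruct (ltQ (addQ u v) w) eqn:H1; [|discriminate] end.
  match type of H with context [ltQ ?u ?v] => destruct (ltQ u v) eqn:H2; [|discriminate] end.
  cbn in H. injection H as Hn.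
  apply ltQ_spec in Hr, H1, H2. rewrite val_0 in Hr. rewrite Hn in *.
  rewrite val_addQ, val_sqrQ, val_tailQ in H1.
  rewrite val_sqrQ, val_sqdistQ in H2 by lia.
  set (xs := nfst (nsnd m)) in *. set (a := nfst (nfst n)) in *. set (r := val (nsnd n)) in *.
  assert (Hxs : (xs <= m)%nat).
  { pose proof (nfst_le (nsnd m)). pose proof (nsnd_le m). unfold xs. lia. }
  assert (Ha : (a <= m)%nat).
  { pose proof (nfst_le m). pose proof (nfst_le n). pose proof (nfst_le (nfst n)). unfold a. lia. }
  set (x0 := val (cnth xs 0)) in *.
  set (xf := fun i => if Nat.leb i m then val (cnth xs i)
                      else if Nat.leb i (m + M) then x0 * (/ 2) ^ Nat.pred i else 0).
  assert (Hsupp : forall i, (S (m + M) <= i)%nat -> xf i = 0).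
  { intros i Hi. unfold xf. destruct (Nat.leb_spec i m); [lia|].
    destruct (Nat.leb_spec i (m + M)); [lia|reflexivity]. }
  set (x := exist (fun x => ex_series (fun n => x n ^ 2)) xf (finite_support_l2 xf _ Hsupp) : l2car).
  assert (Ephi : phi (guess P) M (fun i => coord x i) = val (phiQ P m xs)).
  { rewrite val_phiQ. transitivity (phi (guess P) m xf).
    - rewrite <- (phi_stationary _ _ (m + M) _ P_stationary) by lia.
      apply phi_telescope; [lia|]. intros k Hk. simpl. unfold xf.
      destruct (Nat.leb_spec (S k) m); [lia|]. destruct (Nat.leb_spec (S k) (m + M)); [|lia].
      reflexivity.
    - apply phi_ext. intros i Hi. unfold xf. rewrite coord_alpha.
      destruct (Nat.leb_spec i m); [reflexivity|lia]. }
  exists x. unfold prod_dist, ball_center, ball_radius. cbn [fst snd]. fold (val (nsnd n)). fold a r.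
  apply Rmax_lub_lt; apply sqr_lt_reg; try exact Hr.
  - eapply Rle_lt_trans; [|exact H1]. unfold bdist.
    set (F := fun i => (xf i - val (cnth a i)) ^ 2).
    assert (E : forall i, coord (badd l2 x (bscal l2 (-1) (alpha l2 a))) i
                          = xf i - val (cnth a i)).
    { intros i. cbn [badd bscal l2 proj1_sig]. rewrite coord_alpha. simpl. ring. }
    rewrite (l2_norm_finite _ (S m + M)).
    2: { intros i Hi. rewrite E, Hsupp, cnth_overflow, val_0 by lia. ring. }
    rewrite (fsum_ext _ F) by (intros; now rewrite E).
    assert (E0 : fsum F (S m) = val (sqdistQ xs a (S m))).
    { unfold sqdistQ. rewrite val_sumQ. apply fsum_ext. intros i Hi. unfold F, xf.
      rewrite val_sqrQ, val_subQ. destruct (Nat.leb_spec i m); [reflexivity|lia]. }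
    (* The extra summand makes the induction close: with h the current tail coordinate, h^2 + 2
       (h/2)^2 <= 2 h^2. *)
    assert (Htail : forall j, (j <= M)%nat -> fsum F (S m + j) + 2 * (x0 * (/ 2) ^ (m + j)) ^ 2
                    <= fsum F (S m) + 2 * (x0 * (/ 2) ^ m) ^ 2).
    { induction j as [|j IH]; intros Hj; [rewrite !Nat.add_0_r; lra|].
      rewrite !Nat.add_succ_r.
      change (fsum F (S (S m + j))) with (fsum F (S m + j) + F (S m + j)%nat). specialize (IH ltac:(lia)).
      assert (EF : F (S m + j)%nat = (x0 * (/ 2) ^ (m + j)) ^ 2).
      { unfold F, xf. rewrite (cnth_overflow a), val_0 by lia.
        destruct (Nat.leb_spec (S m + j) m); [lia|].
        destruct (Nat.leb_spec (S m + j) (m + M)); [|lia]. simpl Nat.pred. ring. }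
      rewrite EF. pose proof (pow2_ge_0 (x0 * (/ 2) ^ (m + j))).
      replace (x0 * (/ 2) ^ S (m + j)) with (x0 * (/ 2) ^ (m + j) / 2) by (simpl; field).
      set (h := x0 * (/ 2) ^ (m + j)) in *. lra. }
    specialize (Htail M (le_n M)). pose proof (pow2_ge_0 (x0 * (/ 2) ^ (m + M))). lra.
  - eapply Rle_lt_trans; [|exact H2].
    rewrite (rank1_line _ _ x _ Ephi). apply Rle_refl.
Qed.

(** By continuity of T, x may be replaced by a rational vector. Padding then pushes m past M, where
    [phiQ] is the exact value of the functional, and makes the tail smaller than the room left in
    the ball. *)
Lemma graph_ball_complete n x :
  prod_dist l2 l2 (x, rank1 (guess P) M x) (ball_center l2 l2 n) < ball_radius n ->
  exists m, graph_ball m P = S n.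
Proof.
  unfold prod_dist, ball_center, ball_radius. cbn [fst snd]. fold (val (nsnd n)).
  set (a := nfst (nfst n)). set (b := nsnd (nfst n)). set (r := val (nsnd n)). intros H.
  set (d1 := bdist l2 x (alpha l2 a)) in *. set (d2 := bdist l2 (rank1 _ _ x) (alpha l2 b)) in *.
  assert (H1 : d1 < r) by (eapply Rle_lt_trans; [apply Rmax_l|exact H]).
  assert (H2 : d2 < r) by (eapply Rle_lt_trans; [apply Rmax_r|exact H]).
  assert (P1 : 0 <= d1) by apply l2_norm_nonneg. assert (P2 : 0 <= d2) by apply l2_norm_nonneg.
  destruct (rank1_linear_bounded (guess P) M) as (Tadd & Tscal & C & HC).
  pose proof (bounded_operator_lipschitz l2 l2 _ C Tadd Tscal HC) as Hlip.
  pose proof (Rabs_pos C) as HC0. pose proof (Rle_abs C) as HC1.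
  set (g := Rmin (r - d1) (r - d2)).
  assert (Hg : 0 < g) by (apply Rmin_glb_lt; lra).
  pose proof (Rmin_l (r - d1) (r - d2)). pose proof (Rmin_r (r - d1) (r - d2)). fold g in H0, H3.
  (* Dividing by |C| + 1 keeps both the error of the argument and C times it below the gap [g]. *)
  destruct (alpha_dense l2 l2_banach l2_finite_dense x (g / (Rabs C + 1))) as [xs Hxs].
  { apply Rdiv_lt_0_compat; lra. }
  set (e := bdist l2 (alpha l2 xs) x) in *.
  assert (He : 0 <= e) by apply l2_norm_nonneg.
  assert (Heg : e * (Rabs C + 1) < g).
  { apply (Rmult_lt_compat_r (Rabs C + 1)) in Hxs; [|lra].
    replace (g / (Rabs C + 1) * (Rabs C + 1)) with g in Hxs by (field; lra). exact Hxs. }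
  assert (D1 : bdist l2 (alpha l2 xs) (alpha l2 a) < r).
  { pose proof (bdist_triangle l2 l2_banach (alpha l2 xs) x (alpha l2 a)). fold e d1 in H4. nra. }
  assert (D2 : bdist l2 (rank1 (guess P) M (alpha l2 xs)) (alpha l2 b) < r).
  { pose proof (bdist_triangle l2 l2_banach (rank1 (guess P) M (alpha l2 xs))
      (rank1 (guess P) M x) (alpha l2 b)) as H4. fold d2 in H4.
    specialize (Hlip (alpha l2 xs) x). fold e in Hlip. nra. }
  set (D := bdist l2 (alpha l2 xs) (alpha l2 a)) in *.
  assert (PD : 0 <= D) by apply l2_norm_nonneg.
  set (x0 := val (cnth xs 0)).
  assert (Hgap : 0 < r ^ 2 - D ^ 2) by nra.
  pose proof (pow2_ge_0 x0) as Hx0.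
  (* For m >= k, (2^-m)^2 <= 2^-k, so the tail bound 2 x_0^2 (2^-m)^2 stays below r^2 - D^2. *)
  destruct (halfpow_small ((r ^ 2 - D ^ 2) / (2 * x0 ^ 2 + 1))) as [k Hk].
  { apply Rdiv_lt_0_compat; lra. }
  set (m := npair n (npair xs (k + M))).
  assert (Hn : nfst m = n) by (unfold m; now unpair).
  assert (Hm : nfst (nsnd m) = xs) by (unfold m; now unpair).
  assert (HmM : (k + M <= m)%nat).
  { unfold m. pose proof (nsnd_le (nsnd m)). pose proof (nsnd_le m). unfold m in *.
    rewrite !nsnd_npair in *. lia. }
  assert (Hmxs : (xs <= m)%nat).
  { pose proof (nfst_le (nsnd m)). pose proof (nsnd_le m). lia. }
  assert (Hma : (a <= m)%nat).
  { pose proof (nfst_le m). pose proof (nfst_le n). pose proof (nfst_le (nfst n)). unfold a. lia. }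
  exists m. unfold graph_ball. cbv zeta. rewrite Hn, Hm. fold a b.
  rewrite (proj2 (ltQ_spec 0 (nsnd n))) by (rewrite val_0; fold r; lra).
  rewrite (proj2 (ltQ_spec (addQ _ _) _)).
  2: { rewrite val_addQ, val_sqrQ, val_tailQ, val_sqdistQ by lia. fold D x0 r.
    assert (Hp0 : 0 < (/ 2) ^ m) by (apply pow_lt; lra).
    assert (Hp1 : (/ 2) ^ m <= 1).
    { rewrite <- (pow1 m). apply pow_incr. lra. }
    assert (Hpk : (/ 2) ^ m <= (/ 2) ^ k).
    { replace m with (k + (m - k))%nat by lia. rewrite pow_add.
      rewrite <- (Rmult_1_r ((/ 2) ^ k)) at 2. apply Rmult_le_compat_l; [apply pow_le; lra|].
      rewrite <- (pow1 (m - k)). apply pow_incr. lra. }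
    apply (Rmult_lt_compat_r (2 * x0 ^ 2 + 1)) in Hk; [|lra].
    replace ((r ^ 2 - D ^ 2) / (2 * x0 ^ 2 + 1) * (2 * x0 ^ 2 + 1)) with (r ^ 2 - D ^ 2) in Hk
      by (field; lra).
    rewrite Rpow_mult_distr. set (h := (/ 2) ^ m) in *.
    assert (h ^ 2 <= (/ 2) ^ k) by nra.
    assert (x0 ^ 2 * h ^ 2 <= x0 ^ 2 * (/ 2) ^ k) by (apply Rmult_le_compat_l; lra).
    assert (0 < (/ 2) ^ k) by (apply pow_lt; lra). lra. }
  rewrite (proj2 (ltQ_spec (sqdistQ _ _ _) _)); [reflexivity|].
  rewrite val_sqrQ, val_sqdistQ by lia. fold r.
  rewrite <- (rank1_line (guess P) M (alpha l2 xs)).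
  - assert (0 <= bdist l2 (rank1 (guess P) M (alpha l2 xs)) (alpha l2 b)) by apply l2_norm_nonneg.
    nra.
  - rewrite val_phiQ. symmetry. apply phi_stationary; [exact P_stationary|lia].
Qed.

Lemma graph_ball_names_graph :
  rs_name (APlus l2 l2) (fun m => graph_ball m P) (fun z => rank1 (guess P) M (fst z) = snd z).
Proof.
  split.
  - destruct (rank1_linear_bounded (guess P) M) as (Tadd & Tscal & C & HC).
    exact (bounded_operator_graph_closed l2 l2 l2_banach l2_banach _ C Tadd Tscal HC).
  - intros n. split.
    + intros [m Hm]. destruct (graph_ball_sound m n Hm) as [x Hx].
      exists (x, rank1 (guess P) M x). split; [reflexivity|exact Hx].
    + intros ([x y] & E & Hd). simpl in E. subst y. exact (graph_ball_complete n x Hd).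
Qed.

End GraphBall.

(** * Reading the limit off the value at e_0 *)

Lemma rational_rounding : exists rnd : nat -> nat, computable_nat rnd /\
  forall c n, Rabs (val c - INR n) <= (/ 2) ^ 2 -> rnd c = n.
Proof.
  (* The least t with q + 1/2 < t + 1, where q is the nonnegative part of c, is a nearest integer to
     q. A negative c is within 1/4 of n only if n = 0, and then q = 0. *)
  destruct (computable_min (fun c t => S (2 * qpos c + qden c) - 2 * qden c * S t)%nat)
    as (f & Hf & Hspec).
  - apply computable2_unpair. auto 60 with crec.
  - intros c. exists (2 * qpos c + qden c)%nat. unfold qden. nia.
  - exists f. split; [exact Hf|]. intros c n H. destruct (Hspec c) as [H0 Hm].
    set (t := f c) in *.
    assert (Hz : qpos c = 0%nat \/ qneg c = 0%nat).
    { unfold qpos, qneg. destruct (parity (nfst c)); [right|left]; reflexivity. }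
    apply Rabs_le_between in H. rewrite val_fraction in H. pose proof (qden_pos c) as Hd.
    set (d := INR (qden c)) in *.
    assert (H' : INR n * d - / 4 * d <= INR (qpos c) - INR (qneg c) <= INR n * d + / 4 * d).
    { assert (E : (INR (qpos c) - INR (qneg c)) / d * d = INR (qpos c) - INR (qneg c))
        by (field; lra). set (v := (INR (qpos c) - INR (qneg c)) / d) in *. nra. }
    destruct (Nat.lt_trichotomy t n) as [L|[L|L]]; [|exact L|].
    + exfalso. assert (K : (2 * qpos c + qden c < 2 * qden c * S t)%nat) by lia.
      apply lt_INR in K. rewrite plus_INR, !mult_INR in K. fold d in K.
      apply (le_INR (S t) n) in L. pose proof (pos_INR (qneg c)). change (INR 2) with 2 in K.
      apply (Rmult_le_compat_l d) in L; lra.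
    + exfalso. specialize (Hm n L).
      assert (K : (2 * qden c * S n <= 2 * qpos c + qden c)%nat) by lia.
      apply le_INR in K. rewrite plus_INR, !mult_INR, (S_INR n) in K. fold d in K.
      change (INR 2) with 2 in K. pose proof (pos_INR (qneg c)). pose proof (pos_INR n).
      assert (0 <= INR n * d) by nra.
      destruct Hz as [Hz|Hz]; rewrite Hz in *; change (INR 0) with 0 in *; lra.
Qed.

(** As e_0 belongs to the dense sequence, a constant sequence names it, and the prefixes of this
    name need no oracle. *)
Definition e0_prefix (k : nat) : nat := prec 0 (fun _ r => S (npair e0_code r)) k.

Lemma e0_prefix_enc k : e0_prefix k = enc_list (prefix (fun _ => e0_code) k).
Proof.
  unfold prefix. generalize 0%nat. induction k as [|k IH]; intros s; [reflexivity|].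
  change (e0_prefix (S k)) with (S (npair e0_code (e0_prefix k))). rewrite (IH (S s)). reflexivity.
Qed.

(* position, in a pair [pairB p s], of the k-th query of the associate [s] at e_0 for
   precision 2^-2 *)
Definition query (k : nat) : nat := (2 * npair 2 (e0_prefix k) + 1)%nat.

(** Growing prefixes of the pair meet the queries in the order in which [assoc_eval] asks them, so
    the first answer met is the right one. *)
Lemma query_lt j k : (j < k)%nat -> (query j < query k)%nat.
Proof.
  intros H. assert (L : (e0_prefix j < e0_prefix k)%nat).
  { induction H as [|k H IH].
    - change (e0_prefix (S j)) with (S (npair e0_code (e0_prefix j))). rewrite npair_tri. lia.
    - change (e0_prefix (S k)) with (S (npair e0_code (e0_prefix k))). rewrite npair_tri. lia. }
  unfold query. rewrite !npair_tri.
  pose proof (tri_double (2 + e0_prefix j)). pose proof (tri_double (2 + e0_prefix k)). nia.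
Qed.

(* The answer is the first nonzero query, so it is looked for in the last entry of the
   prefix only. *)
Definition readout (rnd : nat -> nat) (z : nat) : nat :=
  let l := nsnd z in
  let i := Nat.pred (clen l) in
  ifz (clen l) 0 (ifz (absdiff i (query (clen (nsnd (half i)))))
    (ifz (cnth l i) 0 (S (rnd (cnth (Nat.pred (cnth l i)) 0)))) 0).

Lemma readout_computable rnd : computable_nat rnd -> computable_nat (readout rnd).
Proof. intros H. unfold readout, absdiff, query, e0_prefix. cbv zeta. auto 60 with crec. Qed.

(** The use depends on [s], so [assoc_eval_bounded_use] does not apply. A position i is recognised
    as a query by decoding a candidate j from [half i] and comparing i with [query j]. *)
Lemma readout_eval rnd p s r : assoc_eval s (fun _ => e0_code) r ->
  assoc_eval (readout rnd) (pairB p s) (fun _ => rnd (cnth (r 2%nat) 0)).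
Proof.
  intros Hs n. destruct (Hs 2%nat) as (k & Hlt & Hk).
  assert (Hq : forall j, pairB p s (query j) = s (npair 2 (enc_list (prefix (fun _ => e0_code) j)))).
  { intros j. unfold query. now rewrite pairB_odd, e0_prefix_enc. }
  exists (S (query k)). split.
  - intros L HL. unfold readout. cbv zeta. unpair. rewrite clen_prefix.
    destruct L as [|i]; [reflexivity|]. cbn [Nat.pred ifz]. rewrite cnth_prefix by lia.
    set (j := clen (nsnd (half i))).
    destruct (absdiff i (query j)) eqn:E; [|reflexivity]. apply (proj1 (absdiff_eq_0 _ _)) in E.
    assert (Hj : (j < k)%nat).
    { destruct (Nat.lt_trichotomy j k) as [Hj|[Hj|Hj]]; [exact Hj| |]; exfalso.
      - subst k. lia.
      - apply query_lt in Hj. lia. }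
    cbn [ifz]. rewrite E, Hq, (Hlt j Hj). reflexivity.
  - unfold readout. cbv zeta. unpair. rewrite clen_prefix. cbn [Nat.pred ifz].
    rewrite cnth_prefix by lia.
    assert (E : clen (nsnd (half (query k))) = k).
    { replace (half (query k)) with (npair 2 (e0_prefix k)).
      - unpair. now rewrite e0_prefix_enc, clen_prefix.
      - destruct (parity_half (query k)). unfold query in *. lia. }
    rewrite E, (proj2 (absdiff_eq_0 _ _) eq_refl), Hq, Hk. reflexivity.
Qed.

Lemma C_N_le_CGT_l2 : weihrauch_le C_N (CGT l2 l2).
Proof.
  destruct rational_rounding as (rnd & Hrnd & Hround).
  exists (readout rnd).
  exists (fun z => ifz (nfst z - clen (nsnd z)) (S (graph_ball (nfst z) (cnth (nsnd z)))) 0)%nat.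
  split; [now apply readout_computable|split].
  - apply (assoc_bounded_use_computable (fun m => m) graph_ball computable_id).
    exact graph_ball_computable.
  - intros G HG p A Hp HA. destruct (guess_limit p A Hp HA) as (M & HM & HAM).
    destruct (HG (fun m => graph_ball m p) (fun z => rank1 (guess p) M (fst z) = snd z))
      as (s & HGs & T & HsT & _ & HT).
    + exact (graph_ball_names_graph p M HM).
    + exists (rank1 (guess p) M). split; [apply rank1_linear_bounded|]. intros x y. reflexivity.
    + destruct (HsT (fun _ => e0_code) (alpha l2 e0_code)) as (r & Hr & Hname).
      { intros n. rewrite (bdist_refl l2 l2_banach). apply pow_le. lra. }
      exists (fun _ => rnd (cnth (r 2%nat) 0)). split.
      * exists (fun m => graph_ball m p), s. split; [|split; [exact HGs|now apply readout_eval]].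
        apply (assoc_eval_bounded_use (fun m => m) graph_ball). intros m p'. apply graph_ball_use.
      * exists (guess p M). split; [|exact HAM]. simpl. apply Hround.
        (* Entry 2 has error at most 2^-2, the tolerance of [rnd]; the error of a coordinate is at
           most that of the vector, and coordinate 0 of T e_0 is the limit. *)
        eapply Rle_trans; [|apply (Hname 2%nat)].
        replace (T (alpha l2 e0_code)) with (rank1 (guess p) M (alpha l2 e0_code))
          by (symmetry; now apply HT).
        eapply Rle_trans; [|apply (bdist_l2_coord _ _ 0)]. right. f_equal.
        rewrite coord_alpha, coord_rank1. f_equal. cbn [Nat.eqb].
        unfold phi. rewrite (fsum_ext _ (fun _ => 0 * 0)).
        -- rewrite fsum_scal, (coord_line (natQ 1)), val_natQ. simpl. ring.
        -- intros i _. rewrite (coord_line (natQ 1)). simpl. ring.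
Qed.

Theorem theorem5p5 (X Y : BanachData) :
  is_computable_banach_space X ->
  is_computable_banach_space Y ->
  weihrauch_le (CGT X Y) C_N /\ weihrauch_eq C_N (CGT l2 l2).
Proof.
  intros HX HY. split; [now apply CGT_le_C_N|]. split; [exact C_N_le_CGT_l2|].
  apply CGT_le_C_N; exact l2_computable_banach.
Qed.
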